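(* Let $c\in(0,1]$ and $f\in\mathcal{G}(c)$. Then the logarithmic coefficients $\gamma_n$ of $f$ satisfy $$|\gamma_1|\leq \frac{c}{4},\qquad |\gamma_2|\leq \frac{c}{12},\qquad |\gamma_3|\leq \frac{c}{24}.$$ For $n=1,2,3$, equality in the inequality for $|\gamma_n|$ is attained by the function $f\in\mathcal{G}(c)$ with $f(0)=0$ and $f'(z)=(1-z^n)^{c/n}$.
   Context: $\mathbb{D}=\{z\in\mathbb{C}:|z|<1\}$. $\mathcal{A}$ is the class of analytic functions $f$ on $\mathbb{D}$ with $f(0)=f'(0)-1=0$. For $c\in(0,1]$, $$\mathcal{G}(c)=\left\{f\in\mathcal{A}:\ \mathrm{Re}\left(1+\frac{zf''(z)}{f'(z)}\right)<1+\frac{c}{2},\ z\in\mathbb{D}\right\}$$ (in particular $zf''/f'$ is analytic in $\mathbb{D}$). Functions in $\mathcal{G}(c)$ are known to be starlike (hence univalent), so $f(z)/z$ is nonvanishing in $\mathbb{D}$. The logarithmic coefficients $\gamma_n=\gamma_n(f)$ are defined by $\log\frac{f(z)}{z}=2\sum_{n=1}^\infty\gamma_n z^n$ for $z\in\mathbb{D}$, with the branch of the logarithm vanishing at $z=0$. Powers are principal branches (value $1$ at $z=0$). *)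

(* Defs.v *)
From Stdlib Require Import Reals.
From Coquelicot Require Import Coquelicot.

Open Scope R_scope.

Definition unit_disk (z : C) : Prop := Cmod z < 1.

(* Differentiability is over [C_AbsRing], that is, complex. *)
Definition analytic_in_disk (f : C -> C) : Prop :=
  forall z : C, unit_disk z ->
    ex_derive (K := C_AbsRing) (V := C_NormedModule) f z.

Definition class_A (f : C -> C) : Prop :=
  analytic_in_disk f /\ f (RtoC 0) = RtoC 0 /\ C_derive f (RtoC 0) = RtoC 1.

(* [C_derive] and division are total, so the existence of [f''] and the
   nonvanishing of [f'], which make [z f'' / f'] meaningful, are spelled out. *)
Definition class_G (c : R) (f : C -> C) : Prop :=
  class_A f /\
  analytic_in_disk (C_derive f) /\
  forall z : C, unit_disk z ->
    C_derive f z <> RtoC 0 /\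
    Re (1 + z * C_derive (C_derive f) z / C_derive f z)%C < 1 + c / 2.

Definition Cexp (z : C) : C :=
  (exp (Re z) * cos (Im z), exp (Re z) * sin (Im z)).

(* Principal values, for nonzero arguments: [Carg] lies in (-PI, PI]. *)
Definition Carg (w : C) : R :=
  if Rle_dec 0 (Im w) then acos (Re w / Cmod w) else - acos (Re w / Cmod w).

Definition Clog (w : C) : C := (ln (Cmod w), Carg w).

Definition Cpowr (w : C) (a : R) : C := Cexp (RtoC a * Clog w)%C.

(* [L] is the branch of log (f(z)/z) vanishing at the origin; at [z = 0] the
   quotient has value [f'(0) = 1], which agrees with [L 0 = 0]. *)
Definition log_quotient (f L : C -> C) : Prop :=
  analytic_in_disk L /\
  L (RtoC 0) = RtoC 0 /\
  forall z : C, unit_disk z -> z <> RtoC 0 -> Cexp (L z) = (f z / z)%C.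

(* The sum runs over exponents at least 1, so [gamma 0] is unconstrained. *)
Definition log_coeffs (f : C -> C) (gamma : nat -> C) : Prop :=
  exists L : C -> C, log_quotient f L /\
    forall z : C, unit_disk z ->
      is_series (K := C_AbsRing) (V := C_NormedModule)
        (fun k : nat => (2 * (gamma (S k) * z ^ S k))%C) (L z).

Definition extremal (c : R) (n : nat) (f : C -> C) : Prop :=
  f (RtoC 0) = RtoC 0 /\
  forall z : C, unit_disk z ->
    is_derive (K := C_AbsRing) (V := C_NormedModule) f z
      (Cpowr (1 - z ^ n)%C (c / INR n)).

(* Main.v *)
Require Import Defs.
From Stdlib Require Import Reals Lra Lia.
From Coquelicot Require Import Coquelicot.

(** Write [L = log (f(z)/z)] and [q = z L']. Then [f' = exp(L) (1 + q)], so that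
[z f''/f' = q + z q' / (1 + q)], and for [f] in the class [P = 1 - (2/c) z f''/f'] has positive
real part. Let [p_j] be the Taylor coefficients of [P] at the origin, with [p_0 = 1]. Comparing
coefficients up to order three,
  - [gamma_1 = - (c/8) p_1],
  - [gamma_2 = - (c/24) (p_2 - (c/8) p_1^2)],
  - [gamma_3 = - (c/48) (p_3 - (c/4) p_1 p_2)].
All three bounds thus follow from one inequality for functions with positive real part,
[|p_(k+l) - t p_k p_l| <= 2] for [0 <= t <= 1] ([caratheodory_coefficients]); the cases [t = 0] and
[t = 1] with [k = l = 1] together give [|p_1| <= 2].

On a circle of radius [r < 1], [Re P] is the density of a probability whose moments are the
[r^j p_j / 2] ([fourier_coefficient]). Integrating a suitable squared modulus against it gives a
nonnegative number, and this is the inequality. The moments are computed without Cauchy's theorem: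
for [G] holomorphic with period [2 i PI], the integral of [Re G(s + i t)] over a period in [t] does
not depend on [s], since its derivative in [s] is the integral of a derivative in [t]
([mean_constant]), and its limit for [s] tending to minus infinity is read off the Taylor expansion
at the origin. Since [L] is given by a power series, [P] is an explicit quotient of power series; it
is therefore smooth where [f'] does not vanish, and its Taylor coefficients come from formal
division ([quotient_taylor]).

For the extremal functions put [a = c/n]. The binomial series [(1 - x)^a] has first coefficient 1
and all the others nonpositive, with partial sums at least 0. Hence [f(z)/z = U(z^n)], where [U] has
constant coefficient 1 and the moduli of the others add up to at most 1. The reciprocal of such a
series has coefficients bounded by 1 ([recip_bounded]), so [log U], the primitive of [U'/U], is a
power series on the whole disk; its first coefficient [- a/(n+1)] is twice [gamma_n]. *)

Open Scope R_scope.

(** * Complex derivatives *)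

Definition cderiv (f : C -> C) (z l : C) : Prop :=
  is_derive (K := C_AbsRing) (V := C_NormedModule) f z l.

(** The little-o form with the norm [Cmod]: the topology of the normed module on [C] is the
product one, so this is the form in which estimates on moduli can be used. *)
Lemma cderiv_iff (f : C -> C) (z l : C) :
  cderiv f z l <->
  forall e : R, 0 < e -> exists d : R, 0 < d /\ forall w : C, Cmod (w - z) < d ->
    Cmod (f w - f z - l * (w - z)) <= e * Cmod (w - z).
Proof.
split.
- intros [_ H] e He.
  destruct (H z (fun P HP => HP) (mkposreal e He)) as [d Hd].
  exists d; split; [apply cond_pos|]. intros w Hw.
  specialize (Hd w Hw).
  change (Cmod ((f w - f z) - ((w - z) * l)) <= e * Cmod (w - z)) in Hd.
  rewrite (Cmult_comm l). exact Hd.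
- intros H. split.
  + apply (is_linear_scal_l (K := C_AbsRing) (V := C_NormedModule) l).
  + intros x Hx.
    apply (@is_filter_lim_locally_unique C_AbsRing (AbsRing_NormedModule C_AbsRing)) in Hx. subst x.
    intros e. destruct (H e (cond_pos e)) as [d [Hd H']].
    exists (mkposreal d Hd). intros w Hw.
    specialize (H' w Hw).
    change (Cmod ((f w - f z) - ((w - z) * l)) <= e * Cmod (w - z)).
    rewrite (Cmult_comm _ l). exact H'.
Qed.

(** The product uniform structure and the absolute value give two normed modules on [C] with the
same norm, hence the same derivatives; the product rule lives in the second one. *)
Lemma cderiv_absring (f : C -> C) (z l : C) :
  cderiv f z l <-> is_derive (K := C_AbsRing) (V := AbsRing_NormedModule C_AbsRing) f z l.
Proof.
split; intros [[H1 H2 H3] H]; (split; [split; [exact H1 | exact H2 | exact H3] | exact H]).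
Qed.

Lemma cderiv_mult (f g : C -> C) (z a b : C) :
  cderiv f z a -> cderiv g z b ->
  cderiv (fun w => f w * g w)%C z (a * g z + f z * b)%C.
Proof.
intros Hf Hg. apply cderiv_absring in Hf, Hg. apply cderiv_absring.
exact (is_derive_mult (K := C_AbsRing) f g z a b Hf Hg Cmult_comm).
Qed.

Lemma cderiv_comp (f g : C -> C) (z a b : C) :
  cderiv f (g z) a -> cderiv g z b -> cderiv (fun w => f (g w)) z (b * a)%C.
Proof.
intros Hf Hg. apply cderiv_absring in Hg.
exact (is_derive_comp (K := C_AbsRing) f g z a b Hf Hg).
Qed.

Lemma cderiv_plus (f g : C -> C) (z a b : C) :
  cderiv f z a -> cderiv g z b -> cderiv (fun w => f w + g w)%C z (a + b)%C.
Proof. intros Hf Hg.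
exact (is_derive_plus (K := C_AbsRing) (V := C_NormedModule) f g z a b Hf Hg). Qed.

Lemma cderiv_const (k z : C) : cderiv (fun _ => k) z 0%C.
Proof. exact (is_derive_const (K := C_AbsRing) (V := C_NormedModule) k z). Qed.

Lemma cderiv_id (z : C) : cderiv (fun w => w) z 1%C.
Proof. apply cderiv_absring. exact (is_derive_id (K := C_AbsRing) z). Qed.

Lemma cderiv_eq (f : C -> C) (z a b : C) : cderiv f z a -> a = b -> cderiv f z b.
Proof. intros H <-; exact H. Qed.

Lemma cderiv_scal (k : C) (f : C -> C) (z a : C) :
  cderiv f z a -> cderiv (fun w => k * f w)%C z (k * a)%C.
Proof.
intros H. eapply cderiv_eq.
- apply (cderiv_mult (fun _ => k) f z _ _ (cderiv_const k z) H).
- simpl. ring.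
Qed.

Lemma cderiv_opp (f : C -> C) (z a : C) :
  cderiv f z a -> cderiv (fun w => - f w)%C z (- a)%C.
Proof. intros H. exact (is_derive_opp (K := C_AbsRing) (V := C_NormedModule) f z a H). Qed.

Lemma cderiv_minus (f g : C -> C) (z a b : C) :
  cderiv f z a -> cderiv g z b -> cderiv (fun w => f w - g w)%C z (a - b)%C.
Proof. intros Hf Hg. apply cderiv_plus; [exact Hf | apply cderiv_opp, Hg]. Qed.

Lemma cderiv_pow (n : nat) (z : C) :
  cderiv (fun w => w ^ n)%C z (RtoC (INR n) * z ^ pred n)%C.
Proof.
induction n as [|n IH].
- eapply cderiv_eq; [apply (cderiv_const 1%C)|]. simpl. ring.
- eapply cderiv_eq; [apply (cderiv_mult (fun w => w) _ z _ _ (cderiv_id z) IH)|].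
  rewrite S_INR, RtoC_plus.
  destruct n; simpl; ring.
Qed.

Lemma cderiv_ext_ball (f g : C -> C) (z l : C) (d : R) :
  0 < d -> (forall w, Cmod (w - z) < d -> f w = g w) ->
  cderiv f z l -> cderiv g z l.
Proof.
intros Hd Hfg. rewrite !cderiv_iff. intros H e He.
destruct (H e He) as [d' [Hd' H']].
exists (Rmin d d'). split; [apply Rmin_glb_lt; assumption|].
intros w Hw.
rewrite <- (Hfg w), <- (Hfg z).
- apply H'. eapply Rlt_le_trans; [exact Hw|apply Rmin_r].
- replace (z - z)%C with (0:C) by ring. rewrite Cmod_0. exact Hd.
- eapply Rlt_le_trans; [exact Hw|apply Rmin_l].
Qed.

Lemma cderiv_continuous (f : C -> C) (z l : C) :
  cderiv f z l -> forall e, 0 < e -> exists d, 0 < d /\ forall w, Cmod (w - z) < d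
    -> Cmod (f w - f z) < e.
Proof.
intros H e He.
destruct (proj1 (cderiv_iff f z l) H 1 Rlt_0_1) as [d [Hd H']].
pose proof (Cmod_ge_0 l) as Hl.
assert (Hq : 0 < e / (2 + Cmod l)) by (apply Rdiv_lt_0_compat; lra).
exists (Rmin d (e / (2 + Cmod l))). split; [apply Rmin_glb_lt; assumption|].
intros w Hw.
assert (Hw1 : Cmod (w - z) < d) by (eapply Rlt_le_trans; [exact Hw|apply Rmin_l]).
assert (Hw2 : Cmod (w - z) < e / (2 + Cmod l)) by (eapply Rlt_le_trans; [exact Hw|apply Rmin_r]).
specialize (H' w Hw1).
replace (f w - f z)%C with ((f w - f z - l * (w - z)) + l * (w - z))%C by ring.
eapply Rle_lt_trans; [apply Cmod_triangle|]. rewrite (Cmod_mult l).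
assert (Hm : Cmod (w - z) * (2 + Cmod l) < e).
{ apply (Rmult_lt_compat_r (2 + Cmod l)) in Hw2; [|lra].
  replace (e / (2 + Cmod l) * (2 + Cmod l)) with e in Hw2 by (field; lra). exact Hw2. }
pose proof (Cmod_ge_0 (w - z)). nra.
Qed.

Lemma cderiv_inv (f : C -> C) (z a : C) :
  f z <> 0 -> cderiv f z a -> cderiv (fun w => / f w)%C z (- a / (f z * f z))%C.
Proof.
intros Hz Hf.
eapply cderiv_eq.
- apply (cderiv_comp (fun w => / w)%C f z (- / (f z * f z))%C a); [|exact Hf].
  set (y := f z) in *. clearbody y. clear Hf f z a.
  apply cderiv_iff. intros e He.
  assert (Hy : 0 < Cmod y) by (apply Cmod_gt_0; exact Hz).
  assert (Hy3 : 0 < Cmod y * Cmod y * Cmod y) by (repeat apply Rmult_lt_0_compat; exact Hy).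
  exists (Rmin (Cmod y / 2) (e * (Cmod y * Cmod y * Cmod y) / 2)).
  split. { apply Rmin_glb_lt; [lra|]. apply Rdiv_lt_0_compat; [|lra]. apply Rmult_lt_0_compat;
    assumption. }
  intros w Hw.
  assert (Hw1 : Cmod (w - y) < Cmod y / 2) by (eapply Rlt_le_trans; [exact Hw|apply Rmin_l]).
  assert (Hw2 : Cmod (w - y) < e * (Cmod y * Cmod y * Cmod y) / 2)
    by (eapply Rlt_le_trans; [exact Hw|apply Rmin_r]).
  assert (Hwy : Cmod y / 2 < Cmod w).
  { pose proof (Cmod_triangle w (y - w)) as T.
    replace (w + (y - w))%C with y in T by ring.
    replace (y - w)%C with (- (w - y))%C in T by ring. rewrite Cmod_opp in T. lra. }
  assert (Hw0 : w <> 0) by (apply Cmod_gt_0; lra).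
  replace (/ w - / y - - / (y * y) * (w - y))%C with ((w - y) * ((w - y) / (w * (y * y))))%C
    by (field; split; assumption).
  rewrite Cmod_mult, (Rmult_comm e). apply Rmult_le_compat_l; [apply Cmod_ge_0|].
  rewrite Cmod_div by (repeat apply Cmult_neq_0; assumption).
  rewrite !Cmod_mult.
  assert (Hb : 0 < Cmod w * (Cmod y * Cmod y)) by (repeat apply Rmult_lt_0_compat; lra).
  apply (Rmult_le_reg_r (Cmod w * (Cmod y * Cmod y))); [exact Hb|].
  unfold Rdiv. rewrite Rmult_assoc, Rinv_l, Rmult_1_r by lra.
  assert (e * (Cmod y / 2 * (Cmod y * Cmod y)) <= e * (Cmod w * (Cmod y * Cmod y))).
  { apply Rmult_le_compat_l; [lra|]. apply Rmult_le_compat_r; [|lra].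
    apply Rmult_le_pos; lra. }
  lra.
- field. exact Hz.
Qed.

(** Composing with the line [x |-> a + x b] reduces complex derivatives to real ones. *)
Lemma cderiv_line (f : C -> C) (a b l : C) (t : R) :
  cderiv f (a + t * b)%C l ->
  is_derive (fun x : R => Re (f (a + x * b)%C)) t (Re (l * b)).
Proof.
intros H.
assert (HH := proj1 (cderiv_iff _ _ _) H). clear H.
split. { apply (is_linear_scal_l (K := R_AbsRing) (V := R_NormedModule)). }
intros x Hx. apply (@is_filter_lim_locally_unique R_AbsRing R_NormedModule) in Hx. subst x.
intros e.
pose proof (Cmod_ge_0 b) as Hb.
assert (He : 0 < e / (1 + Cmod b)) by (apply Rdiv_lt_0_compat; [apply cond_pos|lra]).
destruct (HH _ He) as [d [Hd H']].
assert (Hd' : 0 < d / (1 + Cmod b)) by (apply Rdiv_lt_0_compat; lra).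
exists (mkposreal _ Hd'). intros y Hy.
change (Rabs (y - t) < d / (1 + Cmod b)) in Hy.
change (Rabs ((Re (f (a + y * b)%C) - Re (f (a + t * b)%C)) - (y - t) * Re (l * b))
  <= e * Rabs (y - t)).
assert (E : (a + y * b - (a + t * b) = RtoC (y - t) * b)%C).
{ rewrite RtoC_minus. ring. }
specialize (H' (a + y * b)%C). rewrite E in H'.
rewrite Cmod_mult, Cmod_R in H'.
assert (H1 : Rabs (y - t) * Cmod b < d).
{ apply (Rmult_lt_compat_r (1 + Cmod b)) in Hy; [|lra].
  replace (d / (1 + Cmod b) * (1 + Cmod b)) with d in Hy by (field; lra).
  pose proof (Rabs_pos (y - t)). nra. }
specialize (H' H1).
assert (E2 : (Re (f (a + y * b)%C) - Re (f (a + t * b)%C)) - (y - t) * Re (l * b)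
  = Re (f (a + y * b)%C - f (a + t * b)%C - l * (RtoC (y - t) * b))%C).
{ unfold Re, Cminus, Cplus, Copp, Cmult, RtoC; simpl. ring. }
rewrite E2. eapply Rle_trans; [apply re_le_Cmod|]. eapply Rle_trans; [exact H'|].
assert (E3 : e / (1 + Cmod b) * (Rabs (y - t) * Cmod b)
  = (e * Rabs (y-t)) * (Cmod b / (1 + Cmod b))) by (field; lra).
rewrite E3. rewrite <- (Rmult_1_r (e * Rabs (y-t))) at 2.
apply Rmult_le_compat_l. { apply Rmult_le_pos; [left; apply cond_pos|apply Rabs_pos]. }
apply (Rmult_le_reg_r (1 + Cmod b)); [lra|]. unfold Rdiv. rewrite Rmult_assoc, Rinv_l by lra. lra.
Qed.

Lemma cderiv_line_im (f : C -> C) (a b l : C) (t : R) :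
  cderiv f (a + t * b)%C l ->
  is_derive (fun x : R => Im (f (a + x * b)%C)) t (Im (l * b)).
Proof.
intros H.
assert (E : forall z, Im z = Re (- Ci * z)%C) by (intros [x y]; unfold Re, Im; simpl; ring).
eapply is_derive_ext; [intros x; symmetry; apply E|].
rewrite E, Cmult_assoc.
apply (cderiv_line (fun w => - Ci * f w)%C). apply cderiv_scal, H.
Qed.

(** The disk is star-shaped about [0], so it is enough to integrate along radii. *)
Lemma cderiv_zero_const (f : C -> C) :
  (forall z, unit_disk z -> cderiv f z 0%C) -> forall z, unit_disk z -> f z = f 0%C.
Proof.
intros H z Hz.
assert (D : forall t, 0 <= t <= 1 -> unit_disk (0 + t * z)%C).
{ intros t Ht. unfold unit_disk in *. rewrite Cplus_0_l, Cmod_mult, Cmod_R, Rabs_pos_eq by lra.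
  pose proof (Cmod_ge_0 z). nra. }
assert (E0 : (0 + 0 * z)%C = 0%C) by ring.
assert (E1 : (0 + 1 * z)%C = z) by ring.
assert (A : forall t, 0 <= t <= 1 -> (0 * z)%C = 0%C) by (intros; ring).
assert (R1 : Re (f (0 + 0 * z)%C) = Re (f (0 + 1 * z)%C)).
{ apply (eq_is_derive (V := R_NormedModule) (fun t => Re (f (0 + t * z)%C)) 0 1); [|lra].
  intros t Ht. replace (@zero R_NormedModule) with (Re (0 * z)) by (rewrite Cmult_0_l; reflexivity).
  apply cderiv_line, H, D, Ht. }
assert (R2 : Im (f (0 + 0 * z)%C) = Im (f (0 + 1 * z)%C)).
{ apply (eq_is_derive (V := R_NormedModule) (fun t => Im (f (0 + t * z)%C)) 0 1); [|lra].
  intros t Ht. replace (@zero R_NormedModule) with (Im (0 * z)) by (rewrite Cmult_0_l; reflexivity).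
  apply cderiv_line_im, H, D, Ht. }
rewrite E0, E1 in *.
destruct (f z), (f 0%C); unfold Re, Im in *; simpl in *; subst; reflexivity.
Qed.

(** * The complex exponential and the principal logarithm *)

Lemma Cexp_plus (z w : C) : Cexp (z + w) = (Cexp z * Cexp w)%C.
Proof.
destruct z as [a b], w as [x y]. unfold Cexp, Cmult, Cplus; simpl.
rewrite exp_plus, cos_plus, sin_plus. f_equal; ring.
Qed.

Lemma Cexp_0 : Cexp 0 = 1%C.
Proof. unfold Cexp; simpl. rewrite exp_0, cos_0, sin_0. unfold RtoC. f_equal; ring. Qed.

Lemma Cexp_opp (z : C) : (Cexp z * Cexp (- z))%C = 1%C.
Proof. rewrite <- Cexp_plus, Cplus_opp_r. apply Cexp_0. Qed.

Lemma Cexp_neq_0 (z : C) : Cexp z <> 0%C.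
Proof. intros H. pose proof (Cexp_opp z) as E. rewrite H, Cmult_0_l in E. apply C1_nz. auto. Qed.

Lemma Cmod_Cexp (z : C) : Cmod (Cexp z) = exp (Re z).
Proof.
unfold Cmod, Cexp; simpl.
replace (_ + _) with (exp (Re z) * exp (Re z)).
- apply sqrt_square. left; apply exp_pos.
- pose proof (sin2_cos2 (Im z)) as H. unfold Rsqr in H.
  transitivity (exp (Re z) * exp (Re z) * (sin (Im z) * sin (Im z) + cos (Im z) * cos (Im z)));
    [rewrite H|]; ring.
Qed.

Lemma sqrt2_le_2 : sqrt 2 <= 2.
Proof. rewrite <- (sqrt_square 2) at 2 by lra. apply sqrt_le_1_alt. lra. Qed.

Lemma real_derive_at_0 (g : R -> R) (l : R) : is_derive g 0 l -> forall e, 0 < e ->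
  exists d, 0 < d /\ forall x, Rabs x < d -> Rabs (g x - g 0 - l * x) <= e * Rabs x.
Proof.
intros [_ H] e He.
destruct (H 0 (fun P HP => HP) (mkposreal e He)) as [d Hd].
exists d; split; [apply cond_pos|]. intros x Hx.
specialize (Hd x).
change (Rabs (x - 0) < d -> Rabs ((g x - g 0) - ((x - 0) * l)) <= e * Rabs (x - 0)) in Hd.
rewrite Rminus_0_r in Hd. rewrite (Rmult_comm l). apply Hd, Hx.
Qed.

(** By the addition formula the point [0] suffices, and there the two components are
[exp x * cos y - 1 - x] and [exp x * sin y - y], which are little-o of the modulus by the real
derivatives of [exp], [cos] and [sin] at [0]. *)
Lemma cderiv_Cexp (z : C) : cderiv Cexp z (Cexp z).
Proof.
assert (H0 : cderiv Cexp 0%C 1%C).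
{ apply cderiv_iff. intros e He.
  set (e' := Rmin (e / 12) 1).
  assert (He' : 0 < e') by (apply Rmin_glb_lt; lra).
  assert (Hee : e' <= e / 12) by apply Rmin_l.
  assert (He1 : e' <= 1) by apply Rmin_r.
  clearbody e'.
  assert (Dexp : is_derive exp 0 1) by (auto_derive; [exact I|rewrite exp_0; ring]).
  destruct (real_derive_at_0 exp 1 Dexp e' He') as [d1 [Hd1 H1]].
  assert (Dcos : is_derive cos 0 0) by (auto_derive; [exact I|rewrite sin_0; ring]).
  destruct (real_derive_at_0 cos 0 Dcos e' He') as [d2 [Hd2 H2]].
  assert (Dsin : is_derive sin 0 1) by (auto_derive; [exact I|rewrite cos_0; ring]).
  destruct (real_derive_at_0 sin 1 Dsin e' He') as [d3 [Hd3 H3]].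
  rewrite exp_0 in H1. rewrite cos_0 in H2. rewrite sin_0 in H3.
  exists (Rmin (Rmin d1 e') (Rmin d2 d3)). split; [repeat apply Rmin_glb_lt; assumption|].
  intros w Hw. rewrite Cexp_0. replace (w - 0)%C with w in * by ring.
  pose proof (Rmax_Cmod w) as HM.
  assert (Hx : Rabs (fst w) <= Cmod w) by (eapply Rle_trans; [apply Rmax_l|exact HM]).
  assert (Hy : Rabs (snd w) <= Cmod w) by (eapply Rle_trans; [apply Rmax_r|exact HM]).
  apply Rmin_Rgt_l in Hw as [Hw1 Hw2]. apply Rmin_Rgt_l in Hw1 as [Hw0 Hw1].
  apply Rmin_Rgt_l in Hw2 as [Hw2 Hw3].
  destruct w as [x y]; simpl in Hx, Hy. set (m := Cmod (x, y)) in *.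
  assert (A1 : Rabs (exp x - 1 - x) <= e' * m).
  { replace (exp x - 1 - x) with (exp x - 1 - 1 * x) by ring.
    eapply Rle_trans; [apply H1; lra|]. apply Rmult_le_compat_l; lra. }
  assert (A2 : Rabs (cos y - 1) <= e' * m).
  { replace (cos y - 1) with (cos y - 1 - 0 * y) by ring.
    eapply Rle_trans; [apply H2; lra|]. apply Rmult_le_compat_l; lra. }
  assert (A3 : Rabs (sin y - y) <= e' * m).
  { replace (sin y - y) with (sin y - 0 - 1 * y) by ring.
    eapply Rle_trans; [apply H3; lra|]. apply Rmult_le_compat_l; lra. }
  assert (Hm : m < e') by lra. assert (Hm0 : 0 <= m) by apply Cmod_ge_0.
  apply Rabs_le_between in A1, A2, A3, Hx, Hy.
  pose proof (COS_bound y) as Bc.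
  assert (E : (Cexp (x, y) - 1 - 1 * (x, y))%C
    = ((exp x - 1 - x) * cos y + (1 + x) * (cos y - 1),
      (exp x - 1 - x) * sin y + x * sin y + (sin y - y))).
  { unfold Cexp, Cminus, Cplus, Copp, Cmult, RtoC; simpl. f_equal; ring. }
  rewrite E. eapply Rle_trans; [apply Cmod_2Rmax|]. simpl.
  pose proof sqrt2_le_2 as Hs2.
  assert (HR : Rmax (Rabs ((exp x - 1 - x) * cos y + (1 + x) * (cos y - 1)))
    (Rabs ((exp x - 1 - x) * sin y + x * sin y + (sin y - y))) <= 6 * (e' * m)).
  { assert (Q : 0 <= e' * m) by (apply Rmult_le_pos; lra).
    pose proof (SIN_bound y) as Bs.
    assert (P1 : Rabs ((exp x - 1 - x) * cos y) <= e' * m).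
    { rewrite Rabs_mult. rewrite <- (Rmult_1_r (e' * m)).
      apply Rmult_le_compat; try apply Rabs_pos; apply Rabs_le; lra. }
    assert (P2 : Rabs ((1 + x) * (cos y - 1)) <= 2 * (e' * m)).
    { rewrite Rabs_mult. apply Rmult_le_compat; try apply Rabs_pos; apply Rabs_le; lra. }
    assert (P3 : Rabs ((exp x - 1 - x) * sin y) <= e' * m).
    { rewrite Rabs_mult. rewrite <- (Rmult_1_r (e' * m)).
      apply Rmult_le_compat; try apply Rabs_pos; apply Rabs_le; lra. }
    assert (P4 : Rabs (x * sin y) <= 2 * (e' * m)).
    { rewrite Rabs_mult. replace (2 * (e' * m)) with (m * (2 * e')) by ring.
      apply Rmult_le_compat; try apply Rabs_pos; apply Rabs_le; [lra|].
      assert (e' * m <= e' * 1) by (apply Rmult_le_compat_l; lra). lra. }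
    apply Rabs_le_between in P1, P2, P3, P4.
    apply Rmax_lub; apply Rabs_le; lra. }
  assert (HR0 : 0 <= Rmax (Rabs ((exp x - 1 - x) * cos y + (1 + x) * (cos y - 1)))
    (Rabs ((exp x - 1 - x) * sin y + x * sin y + (sin y - y))))
      by (eapply Rle_trans; [apply Rabs_pos|apply Rmax_l]).
  assert (e' * m <= e / 12 * m) by (apply Rmult_le_compat_r; lra).
  pose proof (sqrt_pos 2). nra. }
assert (H1 : cderiv (fun w => Cexp (w - z))%C z 1%C).
{ eapply cderiv_eq; [apply (cderiv_comp Cexp (fun w => w - z)%C)|].
  - replace (z - z)%C with (RtoC 0) by ring. exact H0.
  - apply cderiv_minus; [apply cderiv_id|apply cderiv_const].
  - ring. }
eapply (cderiv_ext_ball (fun w => Cexp z * Cexp (w - z))%C _ _ _ 1 Rlt_0_1).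
- intros w _. rewrite <- Cexp_plus. f_equal. ring.
- eapply cderiv_eq; [apply cderiv_scal, H1|ring].
Qed.

(** A function [F] with logarithmic derivative [g = G'] is a constant multiple of [exp G], because
[F exp (- G)] has derivative zero. This identifies power series with exponentials without ever
composing power series. *)
Lemma exp_of_log_derivative (F G g : C -> C) :
  (forall z, unit_disk z -> cderiv G z (g z)) ->
  (forall z, unit_disk z -> cderiv F z (g z * F z)%C) ->
  F 0%C = Cexp (G 0%C) ->
  forall z, unit_disk z -> F z = Cexp (G z).
Proof.
intros HG HF H0 z Hz.
assert (H : (F z * Cexp (- G z))%C = (F 0%C * Cexp (- G 0%C))%C).
{ apply (cderiv_zero_const (fun z => F z * Cexp (- G z))%C); [|exact Hz].
  clear z Hz. intros z Hz. eapply cderiv_eq.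
  - apply cderiv_mult; [apply HF, Hz|].
    apply (cderiv_comp Cexp (fun z => - G z)%C); [apply cderiv_Cexp|apply cderiv_opp, HG, Hz].
  - cbv beta; ring. }
rewrite H0, Cexp_opp in H.
rewrite <- (Cmult_1_r (F z)), <- (Cexp_opp (G z)), (Cmult_comm (Cexp (G z))), Cmult_assoc, H. ring.
Qed.

Lemma Cexp_re_im (z : C) : Re (Cexp z) = exp (Re z) * cos (Im z) /\ Im (Cexp z)
  = exp (Re z) * sin (Im z).
Proof. split; reflexivity. Qed.

Lemma Clog_Cexp (z : C) : - PI < Im z <= PI -> Clog (Cexp z) = z.
Proof.
intros Hz. unfold Clog. rewrite Cmod_Cexp, ln_exp.
assert (E : Carg (Cexp z) = Im z).
{ unfold Carg. rewrite Cmod_Cexp. destruct (Cexp_re_im z) as [-> ->].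
  pose proof (exp_pos (Re z)) as Hp.
  replace (exp (Re z) * cos (Im z) / exp (Re z)) with (cos (Im z)) by (field; lra).
  destruct (Rle_dec 0 (exp (Re z) * sin (Im z))) as [H|H].
  - destruct (Rle_lt_dec 0 (Im z)) as [H0|H0]; [apply acos_cos; lra|].
    exfalso. assert (sin (Im z) < 0) by (apply sin_lt_0_var; lra). nra.
  - destruct (Rle_lt_dec 0 (Im z)) as [H0|H0].
    + exfalso. assert (0 <= sin (Im z)) by (apply sin_ge_0; lra). apply H. nra.
    + rewrite <- cos_neg. rewrite acos_cos by lra. ring. }
rewrite E. destruct z; reflexivity.
Qed.

(** * Complex power series on the unit disk *)

Definition cseries (u : nat -> C) (l : C) : Prop :=
  is_series (K := C_AbsRing) (V := C_NormedModule) u l.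

Definition csum (u : nat -> C) (n : nat) : C := sum_n (G := C_AbelianMonoid) u n.

Lemma csum_S (u : nat -> C) (n : nat) : csum u (S n) = (csum u n + u (S n))%C.
Proof. exact (sum_Sn (G := C_AbelianMonoid) u n). Qed.

Lemma csum_0 (u : nat -> C) : csum u 0 = u 0%nat.
Proof. exact (sum_O (G := C_AbelianMonoid) u). Qed.

Lemma csum_ext (u v : nat -> C) (n : nat) :
  (forall k, (k <= n)%nat -> u k = v k) -> csum u n = csum v n.
Proof. exact (sum_n_ext_loc (G := C_AbelianMonoid) u v n). Qed.

Lemma Re_csum (u : nat -> C) (n : nat) : Re (csum u n) = sum_n (fun k => Re (u k)) n.
Proof.
induction n as [|n IH]; [rewrite csum_0, sum_O; reflexivity|].
rewrite csum_S, sum_Sn, re_plus, IH. reflexivity.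
Qed.

Lemma Im_csum (u : nat -> C) (n : nat) : Im (csum u n) = sum_n (fun k => Im (u k)) n.
Proof.
induction n as [|n IH]; [rewrite csum_0, sum_O; reflexivity|].
rewrite csum_S, sum_Sn, im_plus, IH. reflexivity.
Qed.

Lemma Cmod_csum_le (u : nat -> C) (n : nat) : Cmod (csum u n) <= sum_n (fun k => Cmod (u k)) n.
Proof.
induction n as [|n IH]; [rewrite csum_0, sum_O; lra|].
rewrite csum_S, sum_Sn. eapply Rle_trans; [apply Cmod_triangle|].
apply Rplus_le_compat_r, IH.
Qed.

Lemma cseries_iff (u : nat -> C) (l : C) :
  cseries u l <->
  is_series (fun k => Re (u k)) (Re l) /\ is_series (fun k => Im (u k)) (Im l).
Proof.
unfold cseries, is_series.
split.
- intros H. split; apply filterlim_locally; intros e;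
  generalize (proj1 (filterlim_locally _ _) H e); apply filter_imp; intros n [H1 H2].
  + rewrite <- Re_csum. exact H1.
  + rewrite <- Im_csum. exact H2.
- intros [H1 H2]. apply filterlim_locally. intros e.
  generalize (filter_and _ _ (proj1 (filterlim_locally _ _) H1 e)
    (proj1 (filterlim_locally _ _) H2 e)).
  apply filter_imp. intros n [A1 A2]. split.
  + rewrite <- Re_csum in A1. exact A1.
  + rewrite <- Im_csum in A2. exact A2.
Qed.

Lemma cseries_ext (u v : nat -> C) (l : C) : (forall k, u k = v k) -> cseries u l -> cseries v l.
Proof. exact (is_series_ext (K := C_AbsRing) (V := C_NormedModule) u v l). Qed.

Lemma cseries_plus (u v : nat -> C) (a b : C) :
  cseries u a -> cseries v b -> cseries (fun k => u k + v k)%C (a + b)%C.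
Proof. exact (is_series_plus (K := C_AbsRing) (V := C_NormedModule) u v a b). Qed.

Lemma cseries_scal (c : C) (u : nat -> C) (a : C) :
  cseries u a -> cseries (fun k => c * u k)%C (c * a)%C.
Proof. exact (is_series_scal (K := C_AbsRing) (V := C_NormedModule) c u a). Qed.

Lemma cseries_incr (u : nat -> C) (a : C) :
  cseries (fun k => u (S k)) a <-> cseries u (a + u 0%nat)%C.
Proof.
split; intros H.
- apply cseries_iff in H as [H1 H2]. apply cseries_iff. rewrite re_plus, im_plus. split.
  + apply (is_series_decr_1 (fun k => Re (u k))).
    match goal with |- is_series _ ?x => replace x with (Re a)
      by (change (Re a = (Re a + Re (u 0%nat)) + - Re (u 0%nat)); ring) end.
    exact H1.
  + apply (is_series_decr_1 (fun k => Im (u k))).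
    match goal with |- is_series _ ?x => replace x with (Im a)
      by (change (Im a = (Im a + Im (u 0%nat)) + - Im (u 0%nat)); ring) end.
    exact H2.
- apply cseries_iff in H as [H1 H2]. apply cseries_iff. rewrite re_plus in H1.
  rewrite im_plus in H2.
  split; [exact (is_series_incr_1 (fun k => Re (u k)) _ H1)|exact
    (is_series_incr_1 (fun k => Im (u k)) _ H2)].
Qed.

Lemma Cmod_le_Re_Im (z : C) : Cmod z <= Rabs (Re z) + Rabs (Im z).
Proof.
replace z with (Re z + Ci * Im z)%C at 1
  by (destruct z; unfold Cplus, Cmult, Ci, RtoC, Re, Im; simpl; f_equal; ring).
eapply Rle_trans; [apply Cmod_triangle|]. rewrite Cmod_mult, Cmod_Ci, !Cmod_R. lra.
Qed.

(** The factor 2 comes from bounding the two components separately; only the order of magnitude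
matters in the applications. *)
Lemma cseries_Cmod_le (u : nat -> C) (v : nat -> R) (l : C) (s : R) :
  cseries u l -> is_series v s -> (forall k, Cmod (u k) <= v k) -> Cmod l <= 2 * s.
Proof.
intros Hu Hv Huv. apply cseries_iff in Hu as [H1 H2].
assert (Aux : forall (w : nat -> R) x, is_series w x -> (forall k, Rabs (w k) <= Cmod (u k))
  -> Rabs x <= s).
{ intros w x Hw Hwu. rewrite <- (is_series_unique _ _ Hw), <- (is_series_unique _ _ Hv).
  eapply Rle_trans.
  - apply Series_Rabs. apply (ex_series_le (K := R_AbsRing) (V := R_CompleteNormedModule) _ v).
    + intros n. eapply Rle_trans; [|apply Huv]. eapply Rle_trans; [|apply Hwu].
      change (Rabs (Rabs (w n)) <= Rabs (w n)). rewrite Rabs_Rabsolu. lra.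
    + exists s; exact Hv.
  - apply Series_le; [|exists s; exact Hv].
    intros n. split; [apply Rabs_pos|]. eapply Rle_trans; [apply Hwu|apply Huv]. }
assert (A1 : Rabs (Re l) <= s) by (apply (Aux _ _ H1); intros; apply re_le_Cmod).
assert (A2 : Rabs (Im l) <= s). { apply (Aux _ _ H2). intros k. eapply Rle_trans;
  [|apply Rmax_Cmod]. apply Rmax_r. }
pose proof (Cmod_le_Re_Im l). lra.
Qed.

Definition summable (a : nat -> C) : Prop :=
  forall r : R, 0 <= r < 1 -> ex_series (fun k => Cmod (a k) * r ^ k).

Definition CPS (a : nat -> C) (z : C) : C :=
  (Series (fun k => Re (a k * z ^ k)%C), Series (fun k => Im (a k * z ^ k)%C)).

Lemma Cmod_term (a : nat -> C) (z : C) (k : nat) : Cmod (a k * z ^ k)%C = Cmod (a k) * Cmod z ^ k.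
Proof. rewrite Cmod_mult, Cmod_pow. reflexivity. Qed.

Lemma ex_series_Re (u : nat -> C) : ex_series (fun k => Cmod (u k)) ->
  ex_series (fun k => Rabs (Re (u k))) /\ ex_series (fun k => Rabs (Im (u k))).
Proof.
intros H.
split; (apply (ex_series_le (K := R_AbsRing) (V := R_CompleteNormedModule) _
  (fun k => Cmod (u k))); [|exact H]);
intros n; change (Rabs (Rabs (fst (u n))) <= Cmod (u n)) || change
  (Rabs (Rabs (snd (u n))) <= Cmod (u n)); rewrite Rabs_Rabsolu;
(eapply Rle_trans; [|apply Rmax_Cmod]); [apply Rmax_l|apply Rmax_r].
Qed.

Lemma CPS_correct (a : nat -> C) (z : C) : summable a -> unit_disk z ->
  cseries (fun k => a k * z ^ k)%C (CPS a z).
Proof.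
intros Ha Hz.
destruct (ex_series_Re (fun k => a k * z ^ k)%C) as [H1 H2].
{ apply (ex_series_ext (fun k => Cmod (a k) * Cmod z ^ k)); [intros; symmetry; apply Cmod_term|].
  apply Ha. split; [apply Cmod_ge_0|exact Hz]. }
apply cseries_iff. split; apply Series_correct, ex_series_Rabs; assumption.
Qed.

Lemma CPS_unique (a : nat -> C) (z l : C) : cseries (fun k => a k * z ^ k)%C l -> CPS a z = l.
Proof.
intros H. apply cseries_iff in H as [H1 H2]. unfold CPS.
rewrite (is_series_unique _ _ H1), (is_series_unique _ _ H2). destruct l; reflexivity.
Qed.

Lemma CPS_ext (a b : nat -> C) (z : C) : (forall k, a k = b k) -> CPS a z = CPS b z.
Proof. intros H. unfold CPS. f_equal; apply Series_ext; intros k; rewrite H; reflexivity. Qed.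

Lemma summable_ext (a b : nat -> C) : (forall k, a k = b k) -> summable a -> summable b.
Proof. intros H Ha r Hr. eapply ex_series_ext; [|apply (Ha r Hr)].
intros k; simpl; rewrite H; reflexivity. Qed.

Lemma is_series_zero : is_series (fun _ => 0) 0.
Proof.
apply (filterlim_ext (fun _ => 0)); [|apply filterlim_const].
intros n. rewrite sum_n_const. ring.
Qed.

Lemma CPS_0 (a : nat -> C) : CPS a 0%C = a 0%nat.
Proof.
apply CPS_unique. rewrite <- (Cplus_0_l (a 0%nat)).
replace (0 + a 0%nat)%C with (0 + a 0%nat * 0 ^ 0)%C by (simpl; ring).
apply (cseries_incr (fun k => a k * 0 ^ k)%C).
apply (cseries_ext (fun k => RtoC 0)). { intros k. simpl. ring. }
apply cseries_iff. split; exact is_series_zero.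
Qed.

Lemma CV_radius_of_bounded_terms (a : nat -> C) :
  (forall r, 0 <= r < 1 -> exists M, forall k, Cmod (a k) * r ^ k <= M) ->
  Rbar_le 1 (CV_radius (fun k => Cmod (a k))).
Proof.
intros Ha. destruct (CV_radius_bounded (fun k => Cmod (a k))) as [Hub _].
assert (Hr : forall r, 0 <= r < 1 -> Rbar_le r (CV_radius (fun k => Cmod (a k)))).
{ intros r Hr. apply Hub. destruct (Ha r Hr) as [M HM].
  exists M. intros k. rewrite Rabs_pos_eq; [apply HM|].
  apply Rmult_le_pos; [apply Cmod_ge_0|apply pow_le; lra]. }
destruct (CV_radius (fun k => Cmod (a k))) as [x| |]; simpl in *; auto.
- apply Rnot_lt_le. intros Hx.
  assert (H' : Rmax 0 ((x+1)/2) <= x). { apply Hr. split; [apply Rmax_l|apply Rmax_lub_lt; lra]. }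
  pose proof (Rmax_r 0 ((x+1)/2)). lra.
- apply (Hr 0). lra.
Qed.

Lemma series_terms_bounded (u : nat -> R) : ex_series u -> exists M, forall k, Rabs (u k) <= M.
Proof.
intros H. destruct (filterlim_bounded (K := R_AbsRing) (V := R_NormedModule) u) as [M HM].
- exists 0. apply ex_series_lim_0, H.
- exists M. exact HM.
Qed.

(** Radii of convergence of real power series then give the closure properties of [summable], in
particular under differentiation. *)
Lemma summable_CV_radius (a : nat -> C) :
  summable a <-> Rbar_le 1 (CV_radius (fun k => Cmod (a k))).
Proof.
split.
- intros Ha. apply CV_radius_of_bounded_terms. intros r Hr.
  destruct (series_terms_bounded _ (Ha r Hr)) as [M HM].
  exists M. intros k. eapply Rle_trans; [apply Rle_abs|apply HM].
- intros H r Hr.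
  apply (ex_series_ext (fun k => Rabs (Cmod (a k) * r ^ k))).
  { intros k. apply Rabs_pos_eq. apply Rmult_le_pos; [apply Cmod_ge_0|apply pow_le; lra]. }
  apply CV_disk_inside. rewrite Rabs_pos_eq by lra.
  eapply Rbar_lt_le_trans; [|exact H]. simpl. lra.
Qed.

Lemma summable_of_cseries (a : nat -> C) :
  (forall z, unit_disk z -> exists l, cseries (fun k => a k * z ^ k)%C l) -> summable a.
Proof.
intros H. apply summable_CV_radius, CV_radius_of_bounded_terms. intros r Hr.
destruct (H (RtoC r)) as [l Hl]. { unfold unit_disk. rewrite Cmod_R, Rabs_pos_eq; lra. }
apply cseries_iff in Hl as [H1 H2].
destruct (series_terms_bounded _ (ex_intro _ _ H1)) as [M1 HM1].
destruct (series_terms_bounded _ (ex_intro _ _ H2)) as [M2 HM2].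
exists (M1 + M2). intros k.
replace (Cmod (a k) * r ^ k) with (Cmod (a k * r ^ k)%C)
  by (rewrite Cmod_term, Cmod_R, Rabs_pos_eq by lra; reflexivity).
eapply Rle_trans; [apply Cmod_le_Re_Im|].
apply Rplus_le_compat; [apply HM1|apply HM2].
Qed.

Definition cshift (a : nat -> C) (k : nat) : C := match k with O => 0%C | S j => a j end.
Definition cdiff (a : nat -> C) (k : nat) : C := (INR (S k) * a (S k))%C.

Lemma summable_le (a : nat -> C) (b : nat -> C) :
  (forall k, Cmod (a k) <= Cmod (b k)) -> summable b -> summable a.
Proof.
intros H Hb r Hr.
apply (ex_series_le (K := R_AbsRing) (V := R_CompleteNormedModule) _
  (fun k => Cmod (b k) * r ^ k)); [|apply Hb, Hr].
intros k. change (Rabs (Cmod (a k) * r ^ k) <= Cmod (b k) * r ^ k).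
rewrite Rabs_pos_eq; [|apply Rmult_le_pos; [apply Cmod_ge_0|apply pow_le; lra]].
apply Rmult_le_compat_r; [apply pow_le; lra|apply H].
Qed.

Lemma summable_bounded (a : nat -> C) (M : R) : (forall k, Cmod (a k) <= M) -> summable a.
Proof.
intros H r Hr.
apply (ex_series_le (K := R_AbsRing) (V := R_CompleteNormedModule) _ (fun k => M * r ^ k)).
- intros k. change (Rabs (Cmod (a k) * r ^ k) <= M * r ^ k).
  rewrite Rabs_pos_eq; [|apply Rmult_le_pos; [apply Cmod_ge_0|apply pow_le; lra]].
  apply Rmult_le_compat_r; [apply pow_le; lra|apply H].
- apply (ex_series_scal (K := R_AbsRing) (V := R_NormedModule) M (fun k => r ^ k)).
  apply ex_series_geom. rewrite Rabs_pos_eq; lra.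
Qed.

Lemma summable_cdiff (a : nat -> C) : summable a -> summable (cdiff a).
Proof.
rewrite !summable_CV_radius. intros H.
rewrite (CV_radius_ext _ (PS_derive (fun k => Cmod (a k)))).
- rewrite CV_radius_derive. exact H.
- intros k. unfold cdiff, PS_derive.
  rewrite Cmod_mult, Cmod_R, Rabs_pos_eq; [reflexivity|apply pos_INR].
Qed.

Lemma summable_plus (a b : nat -> C) : summable a -> summable b -> summable (fun k => a k + b k)%C.
Proof.
intros Ha Hb r Hr.
apply (ex_series_le (K := R_AbsRing) (V := R_CompleteNormedModule) _
  (fun k => Cmod (a k) * r ^ k + Cmod (b k) * r ^ k)).
- intros k. change (Rabs (Cmod (a k + b k) * r ^ k) <= Cmod (a k) * r ^ k + Cmod (b k) * r ^ k).
  rewrite Rabs_pos_eq; [|apply Rmult_le_pos; [apply Cmod_ge_0|apply pow_le; lra]].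
  rewrite <- Rmult_plus_distr_r.
  apply Rmult_le_compat_r; [apply pow_le; lra|apply Cmod_triangle].
- apply (ex_series_plus (K := R_AbsRing) (V := R_NormedModule)); [apply Ha|apply Hb]; exact Hr.
Qed.

Lemma summable_scal (c : C) (a : nat -> C) : summable a -> summable (fun k => c * a k)%C.
Proof.
intros Ha r Hr.
apply (ex_series_ext (fun k => Cmod c * (Cmod (a k) * r ^ k))).
- intros k. rewrite Cmod_mult. symmetry. apply Rmult_assoc.
- apply (ex_series_scal (K := R_AbsRing) (V := R_NormedModule) (Cmod c)). apply Ha, Hr.
Qed.

Lemma summable_cshift (a : nat -> C) : summable a -> summable (cshift a).
Proof.
intros Ha r Hr. apply ex_series_incr_1.
apply (ex_series_ext (fun k => r * (Cmod (a k) * r ^ k))).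
- intros k. change (r * (Cmod (a k) * r ^ k) = Cmod (a k) * (r * r ^ k)). ring.
- apply (ex_series_scal (K := R_AbsRing) (V := R_NormedModule) r). apply Ha, Hr.
Qed.

Lemma CPS_cshift (a : nat -> C) (z : C) : summable a -> unit_disk z -> CPS (cshift a) z
  = (z * CPS a z)%C.
Proof.
intros Ha Hz. apply CPS_unique.
replace (z * CPS a z)%C with (z * CPS a z + cshift a 0 * z ^ 0)%C by (simpl; ring).
apply (cseries_incr (fun k => cshift a k * z ^ k)%C).
apply (cseries_ext (fun k => z * (a k * z ^ k))%C). { intros k. simpl. ring. }
apply cseries_scal, CPS_correct; assumption.
Qed.

(** The coefficients of [z] times the derivative. *)
Definition ctheta (a : nat -> C) : nat -> C := cshift (cdiff a).

Lemma summable_ctheta (a : nat -> C) : summable a -> summable (ctheta a).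
Proof. intros Ha. apply summable_cshift, summable_cdiff, Ha. Qed.

Lemma CPS_ctheta (a : nat -> C) (z : C) : summable a -> unit_disk z ->
  CPS (ctheta a) z = (z * CPS (cdiff a) z)%C.
Proof. intros Ha Hz. apply CPS_cshift; [apply summable_cdiff, Ha|exact Hz]. Qed.

Lemma CPS_plus (a b : nat -> C) (z : C) : summable a -> summable b -> unit_disk z ->
  CPS (fun k => a k + b k)%C z = (CPS a z + CPS b z)%C.
Proof.
intros Ha Hb Hz. apply CPS_unique.
apply (cseries_ext (fun k => a k * z ^ k + b k * z ^ k)%C). { intros; ring. }
apply cseries_plus; apply CPS_correct; assumption.
Qed.

Lemma CPS_scal (c : C) (a : nat -> C) (z : C) : summable a -> unit_disk z ->
  CPS (fun k => c * a k)%C z = (c * CPS a z)%C.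
Proof.
intros Ha Hz. apply CPS_unique.
apply (cseries_ext (fun k => c * (a k * z ^ k))%C). { intros; ring. }
apply cseries_scal; apply CPS_correct; assumption.
Qed.

Definition cmul (a b : nat -> C) (n : nat) : C := csum (fun k => a k * b (n - k)%nat)%C n.

(** Mertens' theorem, applied to the four products of real and imaginary parts. *)
Lemma cseries_mult (u v : nat -> C) (a b : C) :
  cseries u a -> cseries v b ->
  ex_series (fun k => Cmod (u k)) -> ex_series (fun k => Cmod (v k)) ->
  cseries (cmul u v) (a * b)%C.
Proof.
intros Hu Hv Au Av.
destruct (ex_series_Re _ Au) as [U1 U2]. destruct (ex_series_Re _ Av) as [V1 V2].
apply cseries_iff in Hu as [Hu1 Hu2]. apply cseries_iff in Hv as [Hv1 Hv2].
apply cseries_iff. rewrite re_mult, im_mult. split.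
- pose proof (is_series_minus _ _ _ _ (is_series_mult _ _ _ _ Hu1 Hv1 U1 V1)
    (is_series_mult _ _ _ _ Hu2 Hv2 U2 V2)) as H.
  eapply is_series_ext; [|exact H]. intros n.
  change (sum_f_R0 (fun k => Re (u k) * Re (v (n - k)%nat)) n - sum_f_R0
    (fun k => Im (u k) * Im (v (n - k)%nat)) n = Re (csum (fun k => u k * v (n - k)%nat)%C n)).
  rewrite Re_csum, sum_n_Reals.
  rewrite <- minus_sum. apply sum_eq. intros i _. rewrite re_mult. ring.
- pose proof (is_series_plus _ _ _ _ (is_series_mult _ _ _ _ Hu1 Hv2 U1 V2)
    (is_series_mult _ _ _ _ Hu2 Hv1 U2 V1)) as H.
  eapply is_series_ext; [|exact H]. intros n.
  change (sum_f_R0 (fun k => Re (u k) * Im (v (n - k)%nat)) n + sum_f_R0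
    (fun k => Im (u k) * Re (v (n - k)%nat)) n = Im (csum (fun k => u k * v (n - k)%nat)%C n)).
  rewrite Im_csum, sum_n_Reals.
  rewrite <- plus_sum. apply sum_eq. intros i _. rewrite im_mult. ring.
Qed.

Lemma csum_mult_r (u : nat -> C) (c : C) (n : nat) : (csum u n * c)%C = csum (fun k => u k * c)%C n.
Proof. induction n as [|n IH]; [rewrite !csum_0; reflexivity|]. rewrite !csum_S, <- IH. ring. Qed.

Lemma summable_cmul (a b : nat -> C) : summable a -> summable b -> summable (cmul a b).
Proof.
intros Ha Hb r Hr.
destruct (Ha r Hr) as [la Hla]. destruct (Hb r Hr) as [lb Hlb].
assert (P : forall (c : nat -> C) k, Rabs (Cmod (c k) * r ^ k) = Cmod (c k) * r ^ k).
{ intros c k. apply Rabs_pos_eq. apply Rmult_le_pos; [apply Cmod_ge_0|apply pow_le; lra]. }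
assert (H : ex_series (fun n => sum_f_R0 (fun k => (Cmod (a k) * r ^ k) *
  (Cmod (b (n - k)%nat) * r ^ (n - k))) n)).
{ exists (la * lb).
  apply (is_series_mult (fun k => Cmod (a k) * r ^ k) (fun k => Cmod (b k) * r ^ k));
    try assumption.
  - apply (ex_series_ext (fun k => Cmod (a k) * r ^ k)); [intros; symmetry; apply P|apply Ha, Hr].
  - apply (ex_series_ext (fun k => Cmod (b k) * r ^ k)); [intros; symmetry; apply P|apply Hb, Hr]. }
apply (ex_series_le (K := R_AbsRing) (V := R_CompleteNormedModule) _ _) with (2 := H).
intros n.
change (Rabs (Cmod (cmul a b n) * r ^ n) <= sum_f_R0
  (fun k => (Cmod (a k) * r ^ k) * (Cmod (b (n - k)%nat) * r ^ (n - k))) n).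
rewrite P. rewrite <- sum_n_Reals. unfold cmul.
eapply Rle_trans; [apply Rmult_le_compat_r; [apply pow_le; lra|apply Cmod_csum_le]|].
rewrite !sum_n_Reals, Rmult_comm, scal_sum. apply sum_Rle. intros k Hk.
rewrite Cmod_mult. replace n with (k + (n - k))%nat at 2 by lia. rewrite pow_add.
right; ring.
Qed.

Lemma CPS_cmul (a b : nat -> C) (z : C) : summable a -> summable b -> unit_disk z ->
  CPS (cmul a b) z = (CPS a z * CPS b z)%C.
Proof.
intros Ha Hb Hz. apply CPS_unique.
apply (cseries_ext (cmul (fun k => a k * z ^ k)%C (fun k => b k * z ^ k)%C)).
- intros n. unfold cmul. rewrite csum_mult_r. apply csum_ext. intros k Hk.
  replace (z ^ n)%C with (z ^ k * z ^ (n - k))%C; [ring|]. rewrite <- Cpow_add_r. f_equal. lia.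
- assert (A : forall c, summable c -> ex_series (fun k => Cmod (c k * z ^ k))).
  { intros c Hc.
    apply (ex_series_ext (fun k => Cmod (c k) * Cmod z ^ k)); [intros; symmetry; apply Cmod_term|].
    apply Hc. split; [apply Cmod_ge_0|exact Hz]. }
  apply cseries_mult; [apply CPS_correct; assumption|apply CPS_correct; assumption|apply A,
    Ha|apply A, Hb].
Qed.

(** Expanding [(z + h) ^ k] by the binomial formula, the left-hand sides are sums of monomials in
[z] and [h] with nonnegative coefficients, so their moduli are at most their values at the
moduli of [z] and [h]. *)
Lemma Cpow_taylor_le (z h : C) (k : nat) :
  Cmod ((z + h) ^ k - z ^ k) <= (Cmod z + Cmod h) ^ k - Cmod z ^ k /\
  Cmod ((z + h) ^ S k - z ^ S k - INR (S k) * z ^ k * h) <=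
   (Cmod z + Cmod h) ^ S k - Cmod z ^ S k - INR (S k) * Cmod z ^ k * Cmod h.
Proof.
pose proof (Cmod_ge_0 z) as Hz. pose proof (Cmod_ge_0 h) as Hh.
set (x := Cmod z) in *. set (y := Cmod h) in *.
induction k as [|k [IH1 IH2]].
- split.
  + replace ((z + h) ^ 0 - z ^ 0)%C with (RtoC 0) by (simpl; ring). rewrite Cmod_0. simpl. lra.
  + replace ((z + h) ^ 1 - z ^ 1 - INR 1 * z ^ 0 * h)%C with (RtoC 0) by (simpl; ring).
    rewrite Cmod_0. simpl. lra.
- assert (A : Cmod ((z + h) ^ S k - z ^ S k) <= (x + y) ^ S k - x ^ S k).
  { replace ((z + h) ^ S k - z ^ S k)%C with ((z + h) * ((z + h) ^ k - z ^ k) + h * z ^ k)%C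
      by (simpl; ring).
    eapply Rle_trans; [apply Cmod_triangle|]. rewrite !Cmod_mult, Cmod_pow. fold x y.
    assert (Cmod (z + h) * Cmod ((z + h) ^ k - z ^ k) <= (x + y) * ((x + y) ^ k - x ^ k)).
    { apply Rmult_le_compat; try apply Cmod_ge_0; [apply Cmod_triangle|exact IH1]. }
    simpl. lra. }
  split; [exact A|].
  replace ((z + h) ^ S (S k) - z ^ S (S k) - INR (S (S k)) * z ^ S k * h)%C
    with (z * ((z + h) ^ S k - z ^ S k - INR (S k) * z ^ k * h) + h * ((z + h) ^ S k - z ^ S k))%C.
  2: { rewrite (S_INR (S k)), RtoC_plus. rewrite !(Cpow_S _ (S k)), !(Cpow_S _ k). ring. }
  eapply Rle_trans; [apply Cmod_triangle|]. rewrite !Cmod_mult. fold x y.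
  assert (x * Cmod ((z + h) ^ S k - z ^ S k - INR (S k) * z ^ k * h)
    <= x * ((x + y) ^ S k - x ^ S k - INR (S k) * x ^ k * y))
      by (apply Rmult_le_compat_l; assumption).
  assert (y * Cmod ((z + h) ^ S k - z ^ S k) <= y * ((x + y) ^ S k - x ^ S k))
    by (apply Rmult_le_compat_l; assumption).
  rewrite (S_INR (S k)). change (x ^ S (S k)) with (x * x ^ S k).
  change ((x+y) ^ S (S k)) with ((x+y) * (x+y) ^ S k).
  change (x ^ S k) with (x * x ^ k) in *. lra.
Qed.

(** By the previous majoration, the remainder [CPS a w - CPS a z - CPS (cdiff a) z * (w - z)] is at
most twice the same remainder for the real power series with coefficients [Cmod (a k)], taken between
[Cmod z] and [Cmod z + Cmod (w - z)]; the latter is little-o since real power series are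
differentiable. *)
Lemma cderiv_CPS (a : nat -> C) (z : C) : summable a -> unit_disk z
  -> cderiv (CPS a) z (CPS (cdiff a) z).
Proof.
intros Ha Hz. pose proof (summable_cdiff a Ha) as Hd.
set (A := PSeries (fun k => Cmod (a k))). set (x := Cmod z).
assert (Hx : 0 <= x < 1) by (split; [apply Cmod_ge_0|exact Hz]).
assert (Hrad : forall r, 0 <= r < 1 -> Rbar_lt (Rabs r) (CV_radius (fun k => Cmod (a k)))).
{ intros r Hr. rewrite Rabs_pos_eq by lra. eapply Rbar_lt_le_trans; [|apply summable_CV_radius, Ha].
  simpl; lra. }
pose proof (is_derive_PSeries _ _ (Hrad x Hx)) as [_ DA].
apply cderiv_iff. intros e He.
assert (He2 : 0 < e / 2) by lra.
destruct (DA x (fun P HP => HP) (mkposreal _ He2)) as [d Hdd].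
exists (Rmin d (1 - x)). split. { apply Rmin_glb_lt; [apply cond_pos|lra]. }
intros w Hw.
assert (Hw1 : Cmod (w - z) < d) by (eapply Rlt_le_trans; [exact Hw|apply Rmin_l]).
assert (Hw2 : Cmod (w - z) < 1 - x) by (eapply Rlt_le_trans; [exact Hw|apply Rmin_r]).
set (h := (w - z)%C) in *. set (y := Cmod h) in *.
assert (Hy : 0 <= y) by apply Cmod_ge_0.
assert (Ew : w = (z + h)%C) by (unfold h; ring).
assert (Hwd : unit_disk w). { unfold unit_disk. rewrite Ew. eapply Rle_lt_trans;
  [apply Cmod_triangle|]. fold x y. lra. }
specialize (Hdd (x + y)).
change (Rabs (x + y - x) < d -> Rabs (A (x + y) - A x - (x + y - x) * PSeries
  (PS_derive (fun k => Cmod (a k))) x) <= e / 2 * Rabs (x + y - x)) in Hdd.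
replace (x + y - x) with y in Hdd by ring. rewrite (Rabs_pos_eq y) in Hdd by exact Hy.
specialize (Hdd Hw1).
eapply Rle_trans.
- apply (cseries_Cmod_le (fun k => a (S k) * ((z + h) ^ S k - z ^ S k - INR (S k) * z ^ k * h))%C
   (fun k => Cmod (a (S k)) * ((x + y) ^ S k - x ^ S k - INR (S k) * x ^ k * y)) _
   (A (x + y) - A x - y * PSeries (PS_derive (fun k => Cmod (a k))) x)).
  + assert (C1 : forall v, unit_disk v -> cseries (fun k => a (S k) * v ^ S k)%C
      (CPS a v - a 0%nat)%C).
    { intros v Hv. apply (cseries_incr (fun k => a k * v ^ k)%C).
      replace (CPS a v - a 0%nat + a 0%nat * v ^ 0)%C with (CPS a v) by (simpl; ring).
      apply CPS_correct; assumption. }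
    pose proof (cseries_plus _ _ _ _ (C1 w Hwd)
      (cseries_plus _ _ _ _ (cseries_scal (- (1))%C _ _ (C1 z Hz))
        (cseries_scal (- h) _ _ (CPS_correct _ _ Hd Hz)))) as H.
    match type of H with cseries _ ?l => replace (CPS a w - CPS a z - CPS (cdiff a) z * h)%C with l
      by ring end.
    eapply cseries_ext; [|exact H]. intros k. cbv beta. unfold cdiff. rewrite Ew. ring.
  + assert (R1 : forall v, 0 <= v < 1 -> is_series (fun k => Cmod (a (S k)) * v ^ S k)
      (A v - Cmod (a 0%nat))).
    { intros v Hv.
      assert (H : is_series (fun k => Cmod (a k) * v ^ k) (A v)) by (apply Series_correct, Ha, Hv).
      apply (is_series_incr_1 (fun k => Cmod (a k) * v ^ k)).
      match goal with |- is_series _ ?l => replace l with (A v)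
        by (change (A v = A v - Cmod (a 0%nat) + Cmod (a 0%nat) * 1); ring) end.
      exact H. }
    assert (R2 : is_series (fun k => INR (S k) * Cmod (a (S k)) * x ^ k)
      (PSeries (PS_derive (fun k => Cmod (a k))) x)).
    { apply Series_correct.
      apply (ex_series_ext (fun k => Cmod (cdiff a k) * x ^ k)); [|apply Hd, Hx].
      intros k. unfold cdiff, PS_derive.
      rewrite Cmod_mult, Cmod_R, Rabs_pos_eq; [reflexivity|apply pos_INR]. }
    assert (Hxy : 0 <= x + y < 1) by lra.
    pose proof (is_series_minus _ _ _ _ (is_series_minus _ _ _ _ (R1 _ Hxy) (R1 _ Hx))
      (is_series_scal y _ _ R2)) as H.
    match type of H with is_series _ ?l => replace
      (A (x + y) - A x - y * PSeries (PS_derive (fun k => Cmod (a k))) x) with l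
      by (unfold minus, plus, opp, scal, mult; simpl; unfold mult; simpl; ring) end.
    eapply is_series_ext; [|exact H]. intros k.
    unfold minus, plus, opp, scal, mult; simpl; unfold mult; simpl. ring.
  + intros k. rewrite Cmod_mult. apply Rmult_le_compat_l; [apply Cmod_ge_0|].
    apply Cpow_taylor_le.
- apply Rabs_le_between in Hdd. change (pos (mkposreal (e / 2) He2)) with (e / 2) in Hdd. lra.
Qed.

Lemma CPS_vanish (a : nat -> C) (m : nat) : summable a -> (forall k, (k < m)%nat -> a k = 0%C) ->
  exists K, 0 <= K /\ forall z, Cmod z <= 1/2 -> Cmod (CPS a z) <= K * Cmod z ^ m.
Proof.
intros Ha H0.
assert (Hh : 0 <= 1/2 < 1) by lra.
destruct (Ha _ Hh) as [s Hs].
assert (Hs0 : 0 <= s).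
{ rewrite <- (is_series_unique _ _ Hs).
  rewrite <- (is_series_unique _ _ is_series_zero).
  apply Series_le; [|exists s; exact Hs].
  intros n. split; [lra|]. apply Rmult_le_pos; [apply Cmod_ge_0|apply pow_le; lra]. }
exists (2 * (2 ^ m * s)).
split. { pose proof (pow_le 2 m). assert (0 <= 2 ^ m * s) by (apply Rmult_le_pos; lra). lra. }
intros z Hz. pose proof (Cmod_ge_0 z) as Hz0.
rewrite Rmult_assoc.
apply (cseries_Cmod_le (fun k => a k * z ^ k)%C
  (fun k => 2 ^ m * Cmod z ^ m * (Cmod (a k) * (1/2) ^ k))).
- apply CPS_correct; [assumption|]. unfold unit_disk. lra.
- replace (2 ^ m * s * Cmod z ^ m) with (2 ^ m * Cmod z ^ m * s) by ring.
  exact (is_series_scal (K := R_AbsRing) (V := R_NormedModule) (2 ^ m * Cmod z ^ m) _ _ Hs).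
- intros k. rewrite Cmod_term. destruct (Nat.lt_ge_cases k m) as [Hk|Hk].
  + rewrite H0, Cmod_0 by exact Hk. rewrite !Rmult_0_l, Rmult_0_r. lra.
  + replace k with (m + (k - m))%nat at 2 4 by lia. rewrite !pow_add.
    replace (2 ^ m * Cmod z ^ m * (Cmod (a k) * ((1 / 2) ^ m * (1 / 2) ^ (k - m))))
      with ((2 ^ m * (1/2) ^ m) * (Cmod (a k) * (Cmod z ^ m * (1 / 2) ^ (k - m)))) by ring.
    rewrite <- Rpow_mult_distr. replace (2 * (1/2)) with 1 by field. rewrite pow1, Rmult_1_l.
    apply Rmult_le_compat_l; [apply Cmod_ge_0|]. apply Rmult_le_compat_l; [apply pow_le; lra|].
    apply pow_incr. lra.
Qed.

(** * Means over circles *)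

(** A second derivative is required only to make the first one continuous, which is what
differentiation under the integral sign needs. *)
Definition twice_derivable (U : C -> Prop) (f : C -> C) : Prop :=
  exists f' : C -> C, forall z, U z -> cderiv f z (f' z) /\ exists l, cderiv f' z l.

Lemma twice_const (U : C -> Prop) (k : C) : twice_derivable U (fun _ => k).
Proof. exists (fun _ => RtoC 0). intros z _. split; [apply cderiv_const|]. eexists.
apply cderiv_const. Qed.

Lemma twice_plus (U : C -> Prop) (f g : C -> C) :
  twice_derivable U f -> twice_derivable U g -> twice_derivable U (fun z => f z + g z)%C.
Proof.
intros [f' Hf] [g' Hg]. exists (fun z => f' z + g' z)%C. intros z Hz.
destruct (Hf z Hz) as [F1 [a F2]], (Hg z Hz) as [G1 [b G2]].
split; [apply cderiv_plus; assumption|]. eexists. apply cderiv_plus; eassumption.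
Qed.

Lemma twice_mult (U : C -> Prop) (f g : C -> C) :
  twice_derivable U f -> twice_derivable U g -> twice_derivable U (fun z => f z * g z)%C.
Proof.
intros [f' Hf] [g' Hg]. exists (fun z => f' z * g z + f z * g' z)%C. intros z Hz.
destruct (Hf z Hz) as [F1 [a F2]], (Hg z Hz) as [G1 [b G2]].
split; [apply cderiv_mult; assumption|]. eexists.
apply cderiv_plus; apply cderiv_mult; eassumption.
Qed.

Lemma twice_minus (U : C -> Prop) (f g : C -> C) :
  twice_derivable U f -> twice_derivable U g -> twice_derivable U (fun z => f z - g z)%C.
Proof.
intros [f' Hf] [g' Hg]. exists (fun z => f' z - g' z)%C. intros z Hz.
destruct (Hf z Hz) as [F1 [a F2]], (Hg z Hz) as [G1 [b G2]].
split; [apply cderiv_minus; assumption|]. eexists. apply cderiv_minus; eassumption.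
Qed.

Lemma twice_inv (U : C -> Prop) (f : C -> C) : (forall z, U z -> f z <> 0%C) ->
  twice_derivable U f -> twice_derivable U (fun z => / f z)%C.
Proof.
intros Hn [f' Hf]. exists (fun z => - f' z / (f z * f z))%C. intros z Hz.
destruct (Hf z Hz) as [F1 [a F2]]. pose proof (Hn z Hz) as H0.
split; [apply cderiv_inv; assumption|]. eexists.
apply cderiv_mult; [apply cderiv_opp, F2|].
apply (cderiv_inv (fun z => f z * f z)%C); [apply Cmult_neq_0; assumption|apply cderiv_mult;
  exact F1].
Qed.

Lemma twice_pow (U : C -> Prop) (f : C -> C) (n : nat) :
  twice_derivable U f -> twice_derivable U (fun z => f z ^ n)%C.
Proof. intros Hf.
induction n as [|n IH]; simpl; [apply twice_const|apply twice_mult; assumption]. Qed.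

Lemma twice_comp (U V : C -> Prop) (f g : C -> C) : (forall z, U z -> V (g z)) ->
  twice_derivable V f -> twice_derivable U g -> twice_derivable U (fun z => f (g z)).
Proof.
intros HUV [f' Hf] [g' Hg]. exists (fun z => g' z * f' (g z))%C. intros z Hz.
destruct (Hf _ (HUV z Hz)) as [F1 [a F2]], (Hg z Hz) as [G1 [b G2]].
split; [apply cderiv_comp; assumption|]. eexists.
apply cderiv_mult; [exact G2|]. apply cderiv_comp; eassumption.
Qed.

Lemma twice_Cexp (U : C -> Prop) : twice_derivable U Cexp.
Proof. exists Cexp. intros z _. split; [apply cderiv_Cexp|]. eexists; apply cderiv_Cexp. Qed.

Lemma twice_Cexp_opp (U : C -> Prop) : twice_derivable U (fun w => Cexp (- w)).
Proof.
apply (twice_comp U (fun _ => True) Cexp Copp); [trivial|apply twice_Cexp|].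
exists (fun _ => - RtoC 1)%C. intros z _.
split; [apply cderiv_opp, cderiv_id|eexists; apply cderiv_const].
Qed.

Lemma twice_csum (U : C -> Prop) (f : nat -> C -> C) (n : nat) :
  (forall k, (k <= n)%nat -> twice_derivable U (f k))
    -> twice_derivable U (fun z => csum (fun k => f k z) n).
Proof.
induction n as [|n IH]; intros H.
- destruct (H O (le_n O)) as [f' Hf]. exists f'. intros z Hz.
  destruct (Hf z Hz) as [F1 F2]. split; [|exact F2].
  eapply (cderiv_ext_ball (f O) _ _ _ 1 Rlt_0_1); [|exact F1]. intros w _. rewrite csum_0.
  reflexivity.
- destruct (twice_plus U (fun z => csum (fun k => f k z) n) (f (S n))) as [g Hg];
    [apply IH; intros; apply H; lia|apply H; lia|].
  exists g. intros z Hz. destruct (Hg z Hz) as [G1 G2]. split; [|exact G2].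
  eapply cderiv_ext_ball; [exact Rlt_0_1| |exact G1]. intros w _. rewrite csum_S. reflexivity.
Qed.

Lemma twice_CPS (a : nat -> C) : summable a -> twice_derivable unit_disk (CPS a).
Proof.
intros Ha. exists (CPS (cdiff a)). intros z Hz. split; [apply cderiv_CPS; assumption|].
eexists. apply cderiv_CPS; [apply summable_cdiff, Ha|exact Hz].
Qed.

Lemma horizontal_derive (G : C -> C) (s t : R) (l : C) :
  cderiv G (s, t) l -> is_derive (fun x => Re (G (x, t))) s (Re l).
Proof.
intros H.
assert (E : forall x : R, ((0, t) + x * 1)%C = (x, t))
  by (intros x; unfold Cplus, Cmult, RtoC; simpl; f_equal; ring).
eapply is_derive_ext; [intros x; rewrite <- E; reflexivity|].
replace (Re l) with (Re (l * 1)) by (rewrite Cmult_1_r; reflexivity).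
apply cderiv_line. rewrite E. exact H.
Qed.

Lemma vertical_derive (G : C -> C) (s t : R) (l : C) :
  cderiv G (s, t) l -> is_derive (fun y => Im (G (s, y))) t (Re l).
Proof.
intros H.
assert (E : forall y : R, ((s, 0) + y * Ci)%C = (s, y))
  by (intros y; unfold Cplus, Cmult, Ci, RtoC; simpl; f_equal; ring).
eapply is_derive_ext; [intros y; rewrite <- E; reflexivity|].
replace (Re l) with (Im (l * Ci)) by (unfold Re, Im, Cmult, Ci; simpl; ring).
apply cderiv_line_im. rewrite E. exact H.
Qed.

Lemma vertical_continuous (G : C -> C) (s t : R) (l : C) :
  cderiv G (s, t) l -> continuous (fun y => Re (G (s, y))) t.
Proof.
intros H. apply (ex_derive_continuous (K := R_AbsRing) (V := R_NormedModule)).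
exists (Re (l * Ci)).
assert (E : forall y : R, ((s, 0) + y * Ci)%C = (s, y))
  by (intros y; unfold Cplus, Cmult, Ci, RtoC; simpl; f_equal; ring).
eapply is_derive_ext; [intros y; rewrite <- E; reflexivity|].
apply cderiv_line. rewrite E. exact H.
Qed.

(** On a vertical line, the real part of the derivative of [H] is the derivative of the imaginary
part of [H], and [H] takes the same value at both ends. *)
Lemma mean_of_derivative (H h : C -> C) (s : R) :
  (forall t, cderiv H (s, t) (h (s, t)) /\ exists l, cderiv h (s, t) l) ->
  H (s, 2 * PI) = H (s, 0) ->
  is_RInt (fun t => Re (h (s, t))) 0 (2 * PI) 0.
Proof.
intros HH Hper.
replace 0 with (minus (Im (H (s, 2 * PI))) (Im (H (s, 0)))) at 2
  by (rewrite Hper; unfold minus, plus, opp; simpl; ring).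
apply (is_RInt_derive (V := R_CompleteNormedModule) (fun t => Im (H (s, t)))
  (fun t => Re (h (s, t)))).
- intros t _. apply vertical_derive, HH.
- intros t _. destruct (HH t) as [_ [l Hl]]. exact (vertical_continuous _ _ _ _ Hl).
Qed.

Definition left_half_plane (w : C) : Prop := Re w < 0.

(** The derivative of the integral with respect to the abscissa is the integral of the real part of
[G'], which vanishes by [mean_of_derivative]. Through [w |-> exp w] this is the independence of
circle means from the radius. *)
Lemma mean_constant (G : C -> C) (s s' : R) :
  twice_derivable left_half_plane G ->
  (forall x, G (x, 2 * PI) = G (x, 0)) -> s < s' < 0 ->
  RInt (fun t => Re (G (s, t))) 0 (2 * PI) = RInt (fun t => Re (G (s', t))) 0 (2 * PI).
Proof.
intros [G' HG] Hper Hs.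
assert (Hhp : forall x t, x < 0 -> left_half_plane (x, t)) by (intros; assumption).
apply (eq_is_derive (V := R_NormedModule) (fun x => RInt (fun t => Re (G (x, t))) 0 (2 * PI)) s
  s'); [|lra].
intros x Hx.
assert (Hx0 : x < 0) by lra.
assert (Hnear : locally x (fun u => u < 0)) by (apply (open_lt 0); exact Hx0).
replace (@zero R_NormedModule) with (RInt (fun t => Derive (fun u => Re (G (u, t))) x) 0 (2 * PI)).
- apply (is_derive_RInt_param (fun u t => Re (G (u, t)))).
  + revert Hnear. apply filter_imp. intros u Hu t _. exists (Re (G' (u, t))).
    apply horizontal_derive, HG, Hhp, Hu.
  + intros t _.
    apply (continuity_2d_pt_ext_loc (fun u v => Re (G' (u, v)))).
    * exists (mkposreal (- x) ltac:(lra)). simpl. intros u v Hu _. symmetry. apply is_derive_unique.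
      apply horizontal_derive, HG, Hhp. apply Rabs_lt_between in Hu. lra.
    * intros e. destruct (HG (x, t) (Hhp x t Hx0)) as [_ [l Hl]].
      destruct (cderiv_continuous _ _ _ Hl e (cond_pos e)) as [d [Hd H]].
      assert (Hd2 : 0 < d / 2) by lra.
      exists (mkposreal _ Hd2). simpl. intros u v Hu Hv.
      eapply Rle_lt_trans; [|apply (H (u, v))].
      { change (Rabs (Re (G' (u, v)) - Re (G' (x, t))) <= Cmod (G' (u, v) - G' (x, t))%C).
        unfold Rminus. rewrite <- re_opp, <- re_plus. apply re_le_Cmod. }
      eapply Rle_lt_trans; [apply Cmod_2Rmax|]. simpl.
      assert (Rmax (Rabs (u + - x)) (Rabs (v + - t)) < d / 2) by (apply Rmax_lub_lt; assumption).
      pose proof sqrt2_le_2.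
      assert (0 <= Rmax (Rabs (u + - x)) (Rabs (v + - t)))
        by (eapply Rle_trans; [apply Rabs_pos|apply Rmax_l]).
      nra.
  + revert Hnear. apply filter_imp. intros u Hu.
    apply (ex_RInt_continuous (V := R_CompleteNormedModule)). intros t _.
    eapply vertical_continuous. apply HG, Hhp, Hu.
- apply is_RInt_unique.
  apply (is_RInt_ext (fun t => Re (G' (x, t)))).
  { intros t _. symmetry. apply is_derive_unique, horizontal_derive, HG, Hhp, Hx0. }
  apply (mean_of_derivative G G'); [|apply Hper].
  intros t. apply HG, Hhp, Hx0.
Qed.

Lemma Cexp_unit_disk (w : C) : left_half_plane w -> unit_disk (Cexp w).
Proof.
intros Hw. unfold unit_disk. rewrite Cmod_Cexp, <- exp_0. apply exp_increasing, Hw.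
Qed.

Lemma unit_disk_0 : unit_disk 0%C.
Proof. unfold unit_disk. rewrite Cmod_0. lra. Qed.

Lemma mean_limit (G : C -> C) (g : C) (s : R) :
  twice_derivable left_half_plane G ->
  (forall x, G (x, 2 * PI) = G (x, 0)) -> s < 0 ->
  (forall e, 0 < e -> exists S, forall w, Re w < S -> Cmod (G w - g) <= e) ->
  is_RInt (fun t => Re (G (s, t))) 0 (2 * PI) (2 * PI * Re g).
Proof.
intros HG Hper Hs Hlim. pose proof PI_RGT_0 as Hpi.
assert (Hex : forall x, x < 0 -> ex_RInt (fun t => Re (G (x, t))) 0 (2 * PI)).
{ intros x Hx. apply (ex_RInt_continuous (V := R_CompleteNormedModule)). intros t _.
  destruct HG as [G' HG]. eapply vertical_continuous. apply HG. exact Hx. }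
assert (E : RInt (fun t => Re (G (s, t))) 0 (2 * PI) = 2 * PI * Re g).
2: { rewrite <- E. apply (RInt_correct (V := R_CompleteNormedModule)), Hex, Hs. }
apply cond_eq. intros e He.
assert (He' : 0 < e / (4 * PI)) by (apply Rdiv_lt_0_compat; lra).
destruct (Hlim _ He') as [S HS].
set (x := Rmin (s - 1) (S - 1)).
assert (Hx1 : x <= s - 1) by apply Rmin_l. assert (Hx2 : x <= S - 1) by apply Rmin_r.
rewrite <- (mean_constant G x s HG Hper) by lra.
assert (Hi : is_RInt (fun t => Re (G (x, t)) - Re g) 0 (2 * PI)
  (RInt (fun t => Re (G (x, t))) 0 (2 * PI) - 2 * PI * Re g)).
{ apply (is_RInt_minus (V := R_NormedModule) (fun t => Re (G (x, t))) (fun _ => Re g)).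
  - apply (RInt_correct (V := R_CompleteNormedModule)), Hex. lra.
  - replace (2 * PI * Re g) with (scal (2 * PI - 0) (Re g))
      by (unfold scal; simpl; unfold mult; simpl; ring).
    apply (is_RInt_const (V := R_NormedModule)). }
assert (Hn : Rabs (RInt (fun t => Re (G (x, t))) 0 (2 * PI) - 2 * PI * Re g)
  <= (2 * PI - 0) * (e / (4 * PI))).
{ apply (norm_RInt_le_const (V := R_NormedModule) (fun t => Re (G (x, t)) - Re g));
    [lra| |exact Hi].
  intros t _. change (Rabs (Re (G (x, t)) - Re g) <= e / (4 * PI)).
  unfold Rminus. rewrite <- re_opp, <- re_plus. eapply Rle_trans; [apply re_le_Cmod|]. apply HS.
  simpl. lra. }
replace ((2 * PI - 0) * (e / (4 * PI))) with (e / 2) in Hn by (field; lra). lra.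
Qed.

Definition has_taylor (P : C -> C) (p : nat -> C) (n : nat) : Prop :=
  exists K d, 0 <= K /\ 0 < d /\ forall z, Cmod z < d ->
    Cmod (P z - csum (fun k => p k * z ^ k)%C n) <= K * Cmod z ^ S n.

Lemma Cexp_2PI (x : R) : Cexp (x, 2 * PI) = Cexp (x, 0).
Proof. unfold Cexp; simpl. rewrite cos_2PI, sin_2PI, cos_0, sin_0. reflexivity. Qed.

Lemma Cexp_opp_2PI (x : R) : Cexp (- (x, 2 * PI)) = Cexp (- (x, 0)).
Proof. unfold Cexp; simpl. rewrite Ropp_0, cos_neg, sin_neg, cos_2PI, sin_2PI, cos_0, sin_0, Ropp_0.
reflexivity. Qed.

Lemma cderiv_csum (f : nat -> C -> C) (d : nat -> C) (z : C) (n : nat) :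
  (forall k, (k <= n)%nat -> cderiv (f k) z (d k))
    -> cderiv (fun w => csum (fun k => f k w) n) z (csum d n).
Proof.
induction n as [|n IH]; intros H.
- rewrite csum_0. eapply (cderiv_ext_ball (f O) _ _ _ 1 Rlt_0_1); [|apply H; lia]. intros w _.
  rewrite csum_0. reflexivity.
- rewrite csum_S.
  eapply (cderiv_ext_ball (fun w => csum (fun k => f k w) n + f (S n) w)%C _ _ _ 1 Rlt_0_1).
  + intros w _. rewrite csum_S. reflexivity.
  + apply cderiv_plus; [apply IH; intros; apply H; lia|apply H; lia].
Qed.

Lemma Cexp_opp_pow (w : C) (j k : nat) : (k <= j)%nat
  -> (Cexp w ^ k * Cexp (- w) ^ j = Cexp (- w) ^ (j - k))%C.
Proof.
intros H. replace j with (k + (j - k))%nat at 1 by lia.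
rewrite Cpow_add_r, Cmult_assoc, <- Cpow_mult_l, Cexp_opp, Cpow_1_l. ring.
Qed.

(** In the variable [z = exp w], the function under the integral is
[A P(z) / z^(i+1) + B P(z) z^(i+1)]. Its polar part is a derivative of a periodic function, so it
has mean zero; what remains tends to [p (S i) * A] as [Re w] tends to minus infinity. *)
Lemma laurent_mean (P : C -> C) (p : nat -> C) (i : nat) (A B : C) (s : R) :
  twice_derivable unit_disk P -> has_taylor P p (S i) -> s < 0 ->
  is_RInt (fun t => Re (P (Cexp (s, t)) * (A * Cexp (- (s, t)) ^ S i + B * Cexp (s, t) ^ S i))%C)
    0 (2 * PI) (2 * PI * Re (p (S i) * A)%C).
Proof.
intros HP [K [d0 [HK [Hd0 HT]]]] Hs. set (j := S i) in *.
set (Q := fun w => csum (fun k => (p k * A) * Cexp (- w) ^ (j - k))%C i).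
assert (HQ : twice_derivable left_half_plane Q).
{ apply (twice_csum _ (fun k w => (p k * A) * Cexp (- w) ^ (j - k))%C). intros k _.
  apply twice_mult; [apply twice_const|]. apply twice_pow, twice_Cexp_opp. }
assert (M1 : is_RInt (fun t => Re (P (Cexp (s, t)) *
  (A * Cexp (- (s, t)) ^ j + B * Cexp (s, t) ^ j) - Q (s, t))%C)
    0 (2 * PI) (2 * PI * Re (p j * A)%C)).
{ apply (mean_limit (fun w => P (Cexp w) * (A * Cexp (- w) ^ j + B * Cexp w ^ j) - Q w)%C).
  - apply twice_minus; [|exact HQ]. apply twice_mult.
    + apply (twice_comp _ unit_disk P Cexp Cexp_unit_disk HP (twice_Cexp _)).
    + apply twice_plus; (apply twice_mult; [apply twice_const|apply twice_pow]);
        [apply twice_Cexp_opp|apply twice_Cexp].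
  - intros x. unfold Q. rewrite Cexp_2PI, Cexp_opp_2PI. reflexivity.
  - exact Hs.
  - intros e He.
    destruct HP as [P' HP]. destruct (HP _ unit_disk_0) as [HP0 _].
    destruct (cderiv_continuous _ _ _ HP0 1 Rlt_0_1) as [d [Hd Hc]].
    set (M := K * Cmod A + Cmod B * (1 + Cmod (P 0%C)) + 1).
    assert (HM : 0 < M). { unfold M. pose proof (Cmod_ge_0 A). pose proof (Cmod_ge_0 B). pose proof
      (Cmod_ge_0 (P 0%C)).
       assert (0 <= K * Cmod A) by (apply Rmult_le_pos; lra).
       assert (0 <= Cmod B * (1 + Cmod (P 0%C))) by (apply Rmult_le_pos; lra). lra. }
    set (d' := Rmin (Rmin d (Rmin d0 1)) (e / M)).
    assert (Hd' : 0 < d'). { unfold d'. assert (0 < e / M)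
      by (apply Rdiv_lt_0_compat; lra). repeat apply Rmin_glb_lt; lra. }
    exists (ln d'). intros w Hw.
    set (z := Cexp w) in *. set (y := Cexp (- w)).
    assert (Hz : Cmod z < d'). { unfold z. rewrite Cmod_Cexp,
      <- (exp_ln d' Hd'). apply exp_increasing, Hw. }
    assert (Hz1 : Cmod z < d) by (eapply Rlt_le_trans; [exact Hz|]; unfold d'; eapply Rle_trans;
      [apply Rmin_l|apply Rmin_l]).
    assert (Hz2 : Cmod z < Rmin d0 1) by (eapply Rlt_le_trans; [exact Hz|]; unfold d';
      eapply Rle_trans; [apply Rmin_l|apply Rmin_r]).
    apply Rmin_Rgt_l in Hz2 as [Hz2 Hz4].
    assert (Hz3 : Cmod z < e / M) by (eapply Rlt_le_trans; [exact Hz|]; apply Rmin_r).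
    assert (Hzy : (z * y = 1)%C) by apply Cexp_opp.
    assert (HQw : (Q w = A * y ^ j * csum (fun k => p k * z ^ k) i)%C).
    { unfold Q. rewrite (Cmult_comm _ (csum _ _)), csum_mult_r. apply csum_ext. intros k Hk.
      rewrite <- Cexp_opp_pow by (unfold j; lia). fold z y. ring. }
    assert (Hj : (z ^ j * y ^ j = 1)%C) by (rewrite <- Cpow_mult_l, Hzy; apply Cpow_1_l).
    replace (P z * (A * y ^ j + B * z ^ j) - Q w - p j * A)%C
      with ((P z - csum (fun k => p k * z ^ k)%C j) * (A * y ^ j) + B * P z * z ^ j)%C.
    2: { rewrite HQw. unfold j at 1. rewrite csum_S. fold j.
         replace (p j * A)%C with (p j * A * (z ^ j * y ^ j))%C by (rewrite Hj; ring). ring. }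
    eapply Rle_trans; [apply Cmod_triangle|]. rewrite !Cmod_mult, !Cmod_pow.
    pose proof (Cmod_ge_0 z) as Hz0.
    assert (Hyz : Cmod z ^ j * Cmod y ^ j = 1).
      { rewrite <- Rpow_mult_distr, <- Cmod_mult, Hzy, Cmod_1. apply pow1. }
    assert (T1 : Cmod (P z - csum (fun k => p k * z ^ k)%C j) * (Cmod A * Cmod y ^ j)
      <= K * Cmod A * Cmod z).
    { eapply Rle_trans; [apply Rmult_le_compat_r; [|apply HT; lra]|].
      - apply Rmult_le_pos; [apply Cmod_ge_0|apply pow_le, Cmod_ge_0].
      - right. change (Cmod z ^ S j) with (Cmod z * Cmod z ^ j).
        replace (K * Cmod A * Cmod z) with (K * Cmod A * Cmod z * (Cmod z ^ j * Cmod y ^ j))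
          by (rewrite Hyz; ring).
        ring. }
    assert (T2 : Cmod B * Cmod (P z) * Cmod z ^ j <= Cmod B * (1 + Cmod (P 0%C)) * Cmod z).
    { apply Rmult_le_compat.
      - apply Rmult_le_pos; apply Cmod_ge_0.
      - apply pow_le, Hz0.
      - apply Rmult_le_compat_l; [apply Cmod_ge_0|].
        replace (P z) with ((P z - P 0%C) + P 0%C)%C by ring.
        eapply Rle_trans; [apply Cmod_triangle|].
        apply Rplus_le_compat_r. left. apply Hc. replace (z - 0)%C with z by ring. exact Hz1.
      - assert (Hzi : Cmod z ^ i <= 1) by (rewrite <- (pow1 i); apply pow_incr; lra).
        change (Cmod z ^ j) with (Cmod z * Cmod z ^ i).
        apply (Rmult_le_compat_l (Cmod z)) in Hzi; lra. }
    assert (Cmod z * M <= e). { apply (Rmult_le_reg_r (/ M));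
      [apply Rinv_0_lt_compat, HM|]. rewrite Rmult_assoc, Rinv_r by lra. unfold Rdiv in Hz3. lra. }
    unfold M in H. lra. }
assert (M2 : is_RInt (fun t => Re (Q (s, t))) 0 (2 * PI) 0).
{ apply (mean_of_derivative (fun w => csum (fun k => (- (p k * A) / INR (j - k)) * Cexp (- w) ^
    (j - k))%C i)).
  - intros t. split.
    + apply (cderiv_csum (fun k w => (- (p k * A) / INR (j - k)) * Cexp (- w) ^ (j - k))%C).
      intros k Hk.
      assert (Hn : RtoC (INR (j - k)) <> 0%C).
        { intros H0. apply RtoC_inj in H0. revert H0. apply not_0_INR. unfold j; lia. }
      eapply cderiv_eq.
      * apply cderiv_scal.
        apply (cderiv_comp (fun w => w ^ (j - k))%C (fun w => Cexp (- w))); [apply cderiv_pow|].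
        apply (cderiv_comp Cexp Copp); [apply cderiv_Cexp|apply cderiv_opp, cderiv_id].
      * assert (Hpos : (0 < j - k)%nat) by (unfold j; lia).
        destruct (j - k)%nat as [|m] eqn:Em; [lia|]. cbn [pred]. rewrite Cpow_S.
        field. exact Hn.
    + destruct HQ as [Q' HQ]. eexists. apply HQ. exact Hs.
  - rewrite Cexp_opp_2PI. reflexivity. }
pose proof (is_RInt_plus (V := R_NormedModule) _ _ _ _ _ _ M1 M2) as M3.
replace (2 * PI * Re (p j * A)%C) with (plus (2 * PI * Re (p j * A)%C) 0) by (apply Rplus_0_r).
eapply is_RInt_ext; [|exact M3]. intros t _.
change (Re (P (Cexp (s, t)) * (A * Cexp (- (s, t)) ^ j + B * Cexp (s, t) ^ j) - Q (s, t))%C + Re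
  (Q (s, t))
  = Re (P (Cexp (s, t)) * (A * Cexp (- (s, t)) ^ j + B * Cexp (s, t) ^ j))%C).
rewrite <- re_plus. f_equal. ring.
Qed.

(** * Coefficients of functions with positive real part *)

Definition circle_point (t : R) : C := (cos t, sin t).

Lemma Cmod_circle_point (t : R) : Cmod (circle_point t) = 1.
Proof.
unfold circle_point, Cmod; simpl. rewrite !Rmult_1_r, Rplus_comm.
change (sqrt (Rsqr (sin t) + Rsqr (cos t)) = 1). rewrite sin2_cos2. apply sqrt_1.
Qed.

Lemma Cexp_polar (r t : R) : 0 < r -> Cexp (ln r, t) = (r * circle_point t)%C.
Proof.
intros Hr. unfold Cexp, circle_point, Cmult, RtoC; simpl. rewrite exp_ln by exact Hr. f_equal; ring.
Qed.

Lemma Cexp_opp_polar (r t : R) : 0 < r -> Cexp (- (ln r, t)) = (/ r * Cconj (circle_point t))%C.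
Proof.
intros Hr. unfold Cexp, circle_point, Cconj; simpl.
rewrite exp_Ropp, exp_ln, cos_neg, sin_neg by exact Hr.
rewrite <- RtoC_inv by lra. unfold Cmult, RtoC; simpl. f_equal; ring.
Qed.

Lemma mean_value (P : C -> C) (r : R) : twice_derivable unit_disk P -> 0 < r < 1 ->
  is_RInt (fun t => Re (P (r * circle_point t)%C)) 0 (2 * PI) (2 * PI * Re (P 0%C)).
Proof.
intros HP Hr.
assert (Hs : ln r < 0) by (rewrite <- ln_1; apply ln_increasing; lra).
apply (is_RInt_ext (fun t => Re (P (Cexp (ln r, t))))).
{ intros t _. rewrite Cexp_polar by lra. reflexivity. }
apply (mean_limit (fun w => P (Cexp w))); [|intros x; rewrite Cexp_2PI; reflexivity|exact Hs|].
- apply (twice_comp _ unit_disk P Cexp Cexp_unit_disk HP (twice_Cexp _)).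
- intros e He. destruct HP as [P' HP].
  destruct (HP _ unit_disk_0) as [HP0 _].
  destruct (cderiv_continuous _ _ _ HP0 e He) as [d [Hd Hc]].
  exists (ln d). intros w Hw. left. apply Hc.
  replace (Cexp w - 0)%C with (Cexp w) by ring.
  rewrite Cmod_Cexp, <- (exp_ln d Hd). apply exp_increasing, Hw.
Qed.

(** The number [Re (a * Cconj q ^ j)] is half the sum of [a * Cconj q ^ j] and its conjugate, and
these two are multiples of [z^(-j)] and [z^j] on the circle of radius [r]. Thus the moments of the
harmonic function [Re P] are the coefficients of [P]. *)
Lemma fourier_coefficient (P : C -> C) (p : nat -> C) (j : nat) (a : C) (r : R) :
  twice_derivable unit_disk P -> has_taylor P p j -> (1 <= j)%nat -> 0 < r < 1 ->
  is_RInt (fun t => Re (P (r * circle_point t)%C) * Re (a * Cconj (circle_point t) ^ j)%C)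
    0 (2 * PI) (PI * r ^ j * Re (a * p j)%C).
Proof.
intros HP HT Hj Hr. destruct j as [|i]; [lia|].
assert (Hs : ln r < 0) by (rewrite <- ln_1; apply ln_increasing; lra).
assert (Hrn : RtoC r <> 0%C) by (intros H; apply RtoC_inj in H; lra).
pose proof (laurent_mean P p i (a * r ^ S i)%C (Cconj a * (/ r) ^ S i)%C (ln r) HP HT Hs) as H.
apply (is_RInt_scal (V := R_NormedModule) _ _ _ (/ 2)) in H.
match type of H with is_RInt _ _ _ ?l => replace (PI * r ^ S i * Re (a * p (S i))%C) with l end.
- eapply is_RInt_ext; [|exact H]. intros t _. cbv beta. set (j := S i).
  rewrite Cexp_polar, Cexp_opp_polar by lra. set (q := circle_point t).
  match goal with |- scal (/ 2) (Re ?X) = _ => replace X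
    with (P (r * q) * RtoC (2 * Re (a * Cconj q ^ j)))%C end.
  + rewrite re_scal_r.
    change (/ 2 * (Re (P (r * q)%C) * (2 * Re (a * Cconj q ^ j)%C))
      = Re (P (r * q)%C) * Re (a * Cconj q ^ j)%C).
    field.
  + f_equal. rewrite !Cpow_mult_l.
    assert (E : ((/ r) ^ j * r ^ j = 1)%C) by
      (rewrite <- Cpow_mult_l, Cinv_l by exact Hrn; apply Cpow_1_l).
    transitivity (a * Cconj q ^ j + Cconj (a * Cconj q ^ j))%C.
    * rewrite RtoC_mult, re_alt. field.
    * rewrite Cmult_conj, Cpow_conj, Cconj_conj.
      transitivity (((/ r) ^ j * r ^ j) * (a * Cconj q ^ j) + ((/ r) ^ j * r ^ j) *
        (Cconj a * q ^ j))%C; [rewrite E|]; ring.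
- change (/ 2 * (2 * PI * Re (p (S i) * (a * r ^ S i))%C) = PI * r ^ S i * Re (a * p (S i))%C).
  replace (p (S i) * (a * r ^ S i))%C with (RtoC (r ^ S i) * (a * p (S i)))%C
    by (rewrite RtoC_pow; ring).
  rewrite re_scal_l. field.
Qed.

Lemma bernoulli_pow (r : R) (n : nat) : 0 <= r <= 1 -> 1 - INR n * (1 - r) <= r ^ n.
Proof.
intros Hr. induction n as [|n IH]; [simpl; lra|].
rewrite S_INR. change (r ^ S n) with (r * r ^ n).
apply (Rmult_le_compat_l r) in IH; [|lra].
assert (0 <= INR n * ((1 - r) * (1 - r))) by (apply Rmult_le_pos; [apply pos_INR|apply Rle_0_sqr]).
nra.
Qed.

Lemma Cmod_sqr (z : C) : Cmod z * Cmod z = Re z * Re z + Im z * Im z.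
Proof. pose proof (Cmod2_alt z) as H. simpl in H. unfold Re, Im in *. lra. Qed.

(** On the circle of radius [r], [Re P] is a probability density whose moments are the
[r^j p_j / 2]. Integrate against it the square of the modulus of [Cconj (e * q^(-l)) - (q^(-k) - b)],
where [q] runs over the unit circle and [b = t r^k p_k]. The result is nonnegative and is
[2 PI] times [2 - t (1 - t) Cmod (r^k p_k) ^ 2 - r^(k+l) Re (e (p_(k+l) - t p_k p_l))]. *)
Lemma caratheodory_radius (P : C -> C) (p : nat -> C) (k l : nat) (t r : R) (e : C) :
  twice_derivable unit_disk P -> (forall z, unit_disk z -> 0 <= Re (P z)) -> P 0%C = 1%C ->
  (1 <= k)%nat -> (1 <= l)%nat ->
  has_taylor P p k -> has_taylor P p l -> has_taylor P p (k + l) ->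
  0 <= t <= 1 -> 0 < r < 1 -> Cmod e = 1 ->
  r ^ (k + l) * Re (e * (p (k + l)%nat - t * (p k * p l)))%C <= 2.
Proof.
intros HP Hre HP0 Hk Hl Tk Tl Tn Ht Hr He.
pose proof PI_RGT_0 as Hpi.
set (b := (t * (r ^ k * p k))%C).
pose proof (mean_value P r HP Hr) as I0. rewrite HP0 in I0.
pose proof (fourier_coefficient P p k (Cconj b) r HP Tk Hk Hr) as Ik.
pose proof (fourier_coefficient P p (k + l) e r HP Tn ltac:(lia) Hr) as In.
pose proof (fourier_coefficient P p l (e * b)%C r HP Tl Hl Hr) as Il.
set (m := 2 + Cmod b * Cmod b).
pose proof (is_RInt_plus (V := R_NormedModule) _ _ _ _ _ _
  (is_RInt_scal (V := R_NormedModule) _ _ _ m _ I0)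
 (is_RInt_scal (V := R_NormedModule) _ _ _ 2 _
  (is_RInt_minus (V := R_NormedModule) _ _ _ _ _ _ Il
    (is_RInt_plus (V := R_NormedModule) _ _ _ _ _ _ Ik In)))) as I.
assert (Hpos : 0 <= m * (2 * PI * 1) + 2 * (PI * r ^ l * Re (e * b * p l)%C -
  (PI * r ^ k * Re (Cconj b * p k)%C + PI * r ^ (k + l) * Re (e * p (k + l)%nat)%C))).
{ match type of I with is_RInt _ _ _ ?v => change (0 <= v) end.
  rewrite <- (is_RInt_unique _ _ _ _ I).
  apply RInt_ge_0; [lra|eexists; exact I|].
  intros x _.
  set (q := circle_point x).
  set (U := Re (P (r * q)%C)).
  assert (HU : 0 <= U).
  { apply Hre. unfold unit_disk. rewrite Cmod_mult, Cmod_R, Rabs_pos_eq by lra.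
    unfold q. rewrite Cmod_circle_point. lra. }
  match goal with |- 0 <= ?X => change X with
    (m * U + 2 * (U * Re (e * b * Cconj q ^ l)%C -
      (U * Re (Cconj b * Cconj q ^ k)%C + U * Re (e * Cconj q ^ (k + l))%C))) end.
  assert (Hq : forall i, Cmod (Cconj q ^ i)%C = 1).
  { intros i. unfold q. rewrite Cmod_pow, Cmod_conj, Cmod_circle_point. apply pow1. }
  rewrite Cpow_add_r.
  pose proof (Hq k) as Wk. pose proof (Hq l) as Wl.
  set (wk := (Cconj q ^ k)%C) in *. set (wl := (Cconj q ^ l)%C) in *.
  (* As [e], [wk] and [wl] have modulus one, the density is multiplied by a squared modulus. *)
  set (X := (Cconj (e * wl) - (wk - b))%C).
  assert (E : m + 2 * (Re (e * b * wl)%C - (Re (Cconj b * wk)%C + Re (e * (wk * wl))%C))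
    = Cmod X * Cmod X).
  { pose proof (Cmod_sqr (e * wl)%C) as H1. rewrite Cmod_mult, He, Wl in H1.
    pose proof (Cmod_sqr wk) as H2. rewrite Wk in H2.
    unfold m. rewrite (Cmod_sqr X), (Cmod_sqr b). unfold X.
    destruct b as [b1 b2], e as [e1 e2], wl as [l1 l2], wk as [k1 k2].
    unfold Re, Im, Cconj, Cminus, Cplus, Copp, Cmult in *; simpl in *. lra. }
  replace (m * U + 2 * (U * Re (e * b * wl)%C -
    (U * Re (Cconj b * wk)%C + U * Re (e * (wk * wl))%C)))
    with (U * (Cmod X * Cmod X)) by (rewrite <- E; ring).
  apply Rmult_le_pos; [exact HU|]. apply Rmult_le_pos; apply Cmod_ge_0. }
assert (E1 : r ^ l * Re (e * b * p l)%C = r ^ (k + l) * Re (e * (t * (p k * p l)))%C).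
{ rewrite <- !re_scal_l. f_equal. unfold b. rewrite pow_add, RtoC_mult, !RtoC_pow. ring. }
assert (E2 : r ^ k * Re (Cconj b * p k)%C = t * (r ^ k * Cmod (p k)) * (r ^ k * Cmod (p k))).
{ unfold b. rewrite !Cmult_conj, Cpow_conj.
  assert (Er : forall x : R, Cconj x = x) by (intros; unfold Cconj, RtoC; simpl; f_equal; ring).
  rewrite !Er, <- RtoC_pow.
  replace (t * (RtoC (r ^ k) * Cconj (p k)) * p k)%C
    with (RtoC (t * r ^ k) * (p k * Cconj (p k)))%C by (rewrite RtoC_mult; ring).
  rewrite <- Cmod2_conj, <- RtoC_mult, re_RtoC. ring. }
assert (E3 : Cmod b * Cmod b = t * t * (r ^ k * Cmod (p k)) * (r ^ k * Cmod (p k))).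
{ unfold b. rewrite !Cmod_mult, Cmod_pow, !Cmod_R, (Rabs_pos_eq t), (Rabs_pos_eq r) by lra. ring. }
replace (Re (e * (p (k + l)%nat - t * (p k * p l)))%C)
  with (Re (e * p (k + l)%nat)%C - Re (e * (t * (p k * p l)))%C).
2: { unfold Rminus. rewrite <- re_opp, <- re_plus. f_equal. ring. }
unfold m in Hpos. rewrite E3 in Hpos.
set (y := r ^ k * Cmod (p k)) in *.
assert (Hpos' : 0 <= PI * (2 * (2 + t * t * y * y) + 2 *
  (r ^ l * Re (e * b * p l)%C - (r ^ k * Re (Cconj b * p k)%C + r ^ (k + l) * Re
    (e * p (k + l)%nat)%C)))) by lra.
assert (H2 : 0 <= 2 * (2 + t * t * y * y) + 2 *
  (r ^ l * Re (e * b * p l)%C - (r ^ k * Re (Cconj b * p k)%C + r ^ (k + l) * Re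
    (e * p (k + l)%nat)%C))).
{ apply (Rmult_le_reg_l PI); [exact Hpi|]. rewrite Rmult_0_r. exact Hpos'. }
rewrite E1, E2 in H2.
assert (0 <= t * (1 - t) * (y * y)) by (apply Rmult_le_pos;
  [apply Rmult_le_pos; lra|apply Rle_0_sqr]).
nra.
Qed.

(** For [t = 0] this is Caratheodory's bound and for [t = 1] it is Livingston's. It follows from
[caratheodory_radius] as [r] tends to [1], with [e] the unimodular number that turns the
complex number on the left into its modulus. *)
Lemma caratheodory_coefficients (P : C -> C) (p : nat -> C) (k l : nat) (t : R) :
  twice_derivable unit_disk P -> (forall z, unit_disk z -> 0 <= Re (P z)) -> P 0%C = 1%C ->
  (1 <= k)%nat -> (1 <= l)%nat ->
  has_taylor P p k -> has_taylor P p l -> has_taylor P p (k + l) ->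
  0 <= t <= 1 ->
  Cmod (p (k + l)%nat - t * (p k * p l)) <= 2.
Proof.
intros HP Hre HP0 Hk Hl Tk Tl Tn Ht.
set (D := (p (k + l)%nat - t * (p k * p l))%C). set (n := (k + l)%nat).
apply Rnot_lt_le. intros HD.
assert (HDn : D <> 0%C) by (apply Cmod_gt_0; lra).
assert (Hn : 1 <= INR n) by (apply (le_INR 1); unfold n; lia).
(* With [r = 1 - x], Bernoulli's inequality gives [r^n * Cmod D >= Cmod D - (Cmod D - 2) / 2 > 2]. *)
set (x := (Cmod D - 2) / (2 * INR n * Cmod D)).
assert (Hden : 0 < 2 * INR n * Cmod D) by (repeat apply Rmult_lt_0_compat; lra).
assert (Hx : 0 < x) by (apply Rdiv_lt_0_compat; lra).
assert (Ex : INR n * x * Cmod D = (Cmod D - 2) / 2) by (unfold x; field; lra).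
assert (Hx1 : x < 1).
{ assert (1 * x <= INR n * x) by (apply Rmult_le_compat_r; lra). nra. }
pose proof (caratheodory_radius P p k l t (1 - x) (Cconj D / Cmod D)%C HP Hre HP0 Hk Hl Tk Tl Tn Ht
  ltac:(lra)) as H.
fold D n in H.
assert (HcD : RtoC (Cmod D) <> 0%C) by (intros E; apply RtoC_inj in E; lra).
replace (Cconj D / Cmod D * D)%C with (RtoC (Cmod D)) in H.
2: { transitivity ((D * Cconj D) / Cmod D)%C; [|field; exact HcD]. rewrite <- Cmod2_conj, RtoC_pow.
     simpl. field. exact HcD. }
rewrite re_RtoC in H.
assert (H' : (1 - x) ^ n * Cmod D <= 2).
{ apply H. rewrite Cmod_div, Cmod_conj, Cmod_R, Rabs_pos_eq by (assumption || lra). field. lra. }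
pose proof (bernoulli_pow (1 - x) n ltac:(lra)) as B.
apply (Rmult_le_compat_r (Cmod D)) in B; [|lra]. nra.
Qed.

(** * Logarithmic coefficients *)

Definition truncate (p : nat -> C) (m k : nat) : C := if (k <=? m)%nat then p k else 0%C.

Lemma csum_truncate (u : nat -> C) (m n : nat) : csum (truncate u m) (m + n) = csum u m.
Proof.
induction n as [|n IH].
- rewrite Nat.add_0_r. apply csum_ext. intros k Hk. unfold truncate.
  destruct (Nat.leb_spec k m); [reflexivity|lia].
- rewrite Nat.add_succ_r, csum_S, IH. unfold truncate at 1.
  destruct (Nat.leb_spec (S (m + n)) m); [lia|]. ring.
Qed.

Lemma CPS_truncate (p : nat -> C) (m : nat) (z : C) : CPS (truncate p m) z
  = csum (fun k => p k * z ^ k)%C m.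
Proof.
apply CPS_unique.
apply (cseries_ext (truncate (fun k => p k * z ^ k)%C m)).
{ intros k. unfold truncate. destruct (k <=? m)%nat; ring. }
unfold cseries, is_series.
apply (filterlim_ext_loc (fun _ => csum (fun k => p k * z ^ k)%C m)); [|apply filterlim_const].
exists m. intros n Hn. replace n with (m + (n - m))%nat by lia. symmetry. apply csum_truncate.
Qed.

Lemma summable_truncate (p : nat -> C) (m : nat) : summable (truncate p m).
Proof.
apply (summable_bounded _ (sum_n (fun k => Cmod (p k)) m)). intros k. unfold truncate.
destruct (Nat.leb_spec k m) as [H|H].
- rewrite sum_n_Reals.
  induction m as [|m IH].
  + replace k with O by lia. simpl. lra.
  + simpl. destruct (Nat.eq_dec k (S m)) as [->|Hne].
    * assert (0 <= sum_f_R0 (fun k => Cmod (p k)) m)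
        by (apply cond_pos_sum; intros; apply Cmod_ge_0).
      lra.
    * assert (k <= m)%nat as Hk by lia. specialize (IH Hk). pose proof (Cmod_ge_0 (p (S m))). lra.
- rewrite Cmod_0, sum_n_Reals. apply cond_pos_sum. intros; apply Cmod_ge_0.
Qed.

(** If [p] is the formal quotient of [n] by [d] up to order [m], then [n - d T], with [T] the
truncation of [p], vanishes to order [m] as a power series, and the value of [d] is close to [1]
near the origin. *)
Lemma quotient_taylor (d n p : nat -> C) (m : nat) :
  summable d -> summable n -> d 0%nat = 1%C ->
  (forall k, (k <= m)%nat -> cmul d p k = n k) ->
  has_taylor (fun z => CPS n z / CPS d z)%C p m.
Proof.
intros Hd Hn Hd0 Hrel.
pose proof (summable_truncate p m) as Hp.
set (e := fun k => (n k + (- RtoC 1) * cmul d (truncate p m) k)%C).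
assert (He : summable e).
{ apply summable_plus; [exact Hn|]. apply summable_scal, summable_cmul; assumption. }
destruct (CPS_vanish e (S m) He) as [K [HK HKz]].
{ intros k Hk. unfold e. rewrite <- Hrel by lia.
  replace (cmul d (truncate p m) k) with (cmul d p k); [ring|].
  apply csum_ext. intros j Hj. unfold truncate.
  destruct (Nat.leb_spec (k - j) m); [reflexivity|lia]. }
destruct (cderiv_continuous _ _ _ (cderiv_CPS d 0%C Hd unit_disk_0) (1/2)) as [r [Hr Hc]]; [lra|].
rewrite CPS_0, Hd0 in Hc.
exists (2 * K), (Rmin r (1/2)). split; [lra|]. split; [apply Rmin_glb_lt; lra|].
intros z Hz. apply Rmin_Rgt_l in Hz as [Hz1 Hz2].
assert (Hzd : unit_disk z) by (unfold unit_disk; lra).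
specialize (Hc z). replace (z - 0)%C with z in Hc by ring. specialize (Hc Hz1).
assert (HD : 1/2 < Cmod (CPS d z)).
{ pose proof (Cmod_triangle (CPS d z) (- (CPS d z - 1))) as T.
  replace (CPS d z + - (CPS d z - 1))%C with (RtoC 1) in T by ring. rewrite Cmod_1, Cmod_opp in T.
  lra. }
assert (HD0 : CPS d z <> 0%C) by (apply Cmod_gt_0; lra).
rewrite <- CPS_truncate.
assert (E : (CPS n z / CPS d z - CPS (truncate p m) z = CPS e z / CPS d z)%C).
{ unfold e.
  rewrite (CPS_plus n (fun k => - RtoC 1 * cmul d (truncate p m) k)%C z Hn)
    by (try apply summable_scal, summable_cmul; assumption).
  rewrite CPS_scal by (try apply summable_cmul; assumption). rewrite CPS_cmul by assumption. field.
  exact HD0. }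
rewrite E, Cmod_div by exact HD0.
specialize (HKz z ltac:(lra)).
apply (Rmult_le_reg_r (Cmod (CPS d z))); [lra|]. unfold Rdiv.
rewrite Rmult_assoc, Rinv_l, Rmult_1_r by lra.
assert (0 <= K * Cmod z ^ S m) by (apply Rmult_le_pos; [exact HK|apply pow_le, Cmod_ge_0]).
nra.
Qed.

(** The coefficients of [log (f(z)/z)]. *)
Definition log_series (gamma : nat -> C) (k : nat) : C :=
  match k with O => 0%C | S _ => (2 * gamma k)%C end.

Lemma log_quotient_series (f : C -> C) (gamma : nat -> C) :
  f 0%C = 0%C -> log_coeffs f gamma ->
  summable (log_series gamma) /\
  forall z, unit_disk z -> f z = (z * Cexp (CPS (log_series gamma) z))%C.
Proof.
intros Hf0 [L [[_ [_ HL]] Hs]].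
assert (H : forall z, unit_disk z -> cseries (fun k => log_series gamma k * z ^ k)%C (L z)).
{ intros z Hz. replace (L z) with (L z + log_series gamma 0 * z ^ 0)%C by (simpl; ring).
  apply (cseries_incr (fun k => log_series gamma k * z ^ k)%C).
  eapply cseries_ext; [|exact (Hs z Hz)]. intros k. cbv beta. unfold log_series. ring. }
split.
- apply summable_of_cseries. intros z Hz. eexists. apply H, Hz.
- intros z Hz. destruct (Ceq_dec z 0%C) as [Hz0|Hz0].
  + rewrite Hz0, Hf0. ring.
  + rewrite (CPS_unique _ _ _ (H z Hz)), HL by assumption. field. exact Hz0.
Qed.

(** For [f(z) = z exp (A(z))] and [q(z) = z A'(z)], these are the coefficients of [1 + q], which is
[z f'(z) / f(z)]. *)
Definition den_series (a : nat -> C) (k : nat) : C :=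
  match k with O => 1%C | S _ => ctheta a k end.

(** With [q] as above, [z f''(z) / f'(z) = q + z q' / (1 + q)]; multiplied by [1 + q], the function
[1 - (2 / c) z f'' / f'] has these coefficients. *)
Definition num_series (c : R) (a : nat -> C) (k : nat) : C :=
  (den_series a k + (- RtoC (2 / c)) *
    (cmul (ctheta a) (den_series a) k + ctheta (ctheta a) k))%C.

Lemma den_series_eq (a : nat -> C) (k : nat) :
  (truncate (fun _ => 1) 0 k + ctheta a k)%C = den_series a k.
Proof. destruct k; unfold truncate; simpl; ring. Qed.

Lemma summable_den (a : nat -> C) : summable a -> summable (den_series a).
Proof.
intros Ha.
apply (summable_ext (fun k => truncate (fun _ => RtoC 1) 0 k + ctheta a k)%C);
  [exact (den_series_eq a)|].
apply summable_plus; [apply summable_truncate|apply summable_ctheta, Ha].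
Qed.

Lemma summable_num (c : R) (a : nat -> C) : summable a -> summable (num_series c a).
Proof.
intros Ha. apply summable_plus; [apply summable_den, Ha|]. apply summable_scal, summable_plus.
- apply summable_cmul; [apply summable_ctheta, Ha|apply summable_den, Ha].
- apply summable_ctheta, summable_ctheta, Ha.
Qed.

Lemma CPS_den (a : nat -> C) (z : C) : summable a -> unit_disk z ->
  CPS (den_series a) z = (1 + CPS (ctheta a) z)%C.
Proof.
intros Ha Hz. rewrite <- (CPS_ext _ _ z (den_series_eq a)).
rewrite (CPS_plus _ _ z (summable_truncate (fun _ => RtoC 1) 0) (summable_ctheta a Ha) Hz).
rewrite CPS_truncate, csum_0. simpl. ring.
Qed.

Lemma CPS_num (c : R) (a : nat -> C) (z : C) : summable a -> unit_disk z ->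
  CPS (num_series c a) z =
  (CPS (den_series a) z - RtoC (2 / c) *
    (CPS (ctheta a) z * CPS (den_series a) z + z * CPS (cdiff (ctheta a)) z))%C.
Proof.
intros Ha Hz. unfold num_series.
pose proof (summable_ctheta a Ha) as Sq. pose proof (summable_den a Ha) as Sd.
pose proof (summable_ctheta _ Sq) as Sz. pose proof (summable_cmul _ _ Sq Sd) as Sqd.
rewrite (CPS_plus (den_series a) (fun k => - RtoC (2/c) *
  (cmul (ctheta a) (den_series a) k + ctheta (ctheta a) k))%C z Sd)
  by (try apply summable_scal, summable_plus; assumption).
rewrite CPS_scal by (try apply summable_plus; assumption).
rewrite (CPS_plus (cmul (ctheta a) (den_series a)) (ctheta (ctheta a)) z Sqd Sz Hz).
rewrite (CPS_cmul _ _ z Sq Sd Hz), (CPS_ctheta (ctheta a) z Sq Hz). ring.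
Qed.

Lemma disk_neighbourhood (z : C) : unit_disk z ->
  exists d, 0 < d /\ forall w, Cmod (w - z) < d -> unit_disk w.
Proof.
intros Hz. exists (1 - Cmod z). split; [unfold unit_disk in Hz; lra|]. intros w Hw.
unfold unit_disk. replace w with (z + (w - z))%C by ring.
eapply Rle_lt_trans; [apply Cmod_triangle|]. lra.
Qed.

Lemma C_derive_z_exp (f : C -> C) (a : nat -> C) (z : C) : summable a ->
  (forall w, unit_disk w -> f w = (w * Cexp (CPS a w))%C) -> unit_disk z ->
  C_derive f z = (Cexp (CPS a z) * CPS (den_series a) z)%C.
Proof.
intros Ha Hf Hz. apply is_C_derive_unique.
destruct (disk_neighbourhood z Hz) as [d [Hd Hnear]].
apply (cderiv_ext_ball (fun w => w * Cexp (CPS a w))%C _ _ _ d Hd).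
- intros w Hw. symmetry. apply Hf, Hnear, Hw.
- eapply cderiv_eq.
  + apply cderiv_mult; [apply cderiv_id|].
    apply (cderiv_comp Cexp); [apply cderiv_Cexp|apply cderiv_CPS; assumption].
  + cbv beta. rewrite CPS_den, CPS_ctheta by assumption. ring.
Qed.

Lemma C_derive2_z_exp (f : C -> C) (a : nat -> C) (z : C) : summable a ->
  (forall w, unit_disk w -> f w = (w * Cexp (CPS a w))%C) -> unit_disk z ->
  C_derive (C_derive f) z = (Cexp (CPS a z) *
    (CPS (cdiff a) z * CPS (den_series a) z + CPS (cdiff (ctheta a)) z))%C.
Proof.
intros Ha Hf Hz. apply is_C_derive_unique.
destruct (disk_neighbourhood z Hz) as [d [Hd Hnear]].
apply (cderiv_ext_ball (fun w => Cexp (CPS a w) * (1 + CPS (ctheta a) w))%C _ _ _ d Hd).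
- intros w Hw. rewrite (C_derive_z_exp f a w Ha Hf), CPS_den by (try apply Hnear; assumption).
  reflexivity.
- eapply cderiv_eq.
  + apply cderiv_mult.
    * apply (cderiv_comp Cexp); [apply cderiv_Cexp|apply cderiv_CPS; assumption].
    * apply cderiv_plus; [apply cderiv_const|apply cderiv_CPS; [apply summable_ctheta|];
        assumption].
  + cbv beta. rewrite CPS_den by assumption. ring.
Qed.

Definition caratheodory_fun (c : R) (a : nat -> C) (z : C) : C :=
  (CPS (num_series c a) z / CPS (den_series a) z)%C.

(** The coefficients of the quotient, from
[z f''/f' = 2 q_1 z + (3 q_2 - q_1^2) z^2 + (4 q_3 - 3 q_1 q_2 + q_1^3) z^3 + O(z^4)]. *)
Definition caratheodory_coef (c : R) (a : nat -> C) (k : nat) : C :=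
  let q := ctheta a in
  match k with
  | 0 => 1
  | 1 => - RtoC (2 / c) * (2 * q 1%nat)
  | 2 => - RtoC (2 / c) * (3 * q 2%nat - q 1%nat * q 1%nat)
  | 3 => - RtoC (2 / c) * (4 * q 3%nat - 3 * q 1%nat * q 2%nat + q 1%nat * q 1%nat * q 1%nat)
  | _ => 0
  end%C.

Lemma caratheodory_taylor (c : R) (a : nat -> C) (m : nat) :
  summable a -> (m <= 3)%nat -> has_taylor (caratheodory_fun c a) (caratheodory_coef c a) m.
Proof.
intros Ha Hm. apply quotient_taylor; [apply summable_den, Ha|apply summable_num, Ha|reflexivity|].
intros k Hk. unfold num_series, den_series, caratheodory_coef, cmul.
set (q := ctheta a). assert (Hq0 : q 0%nat = 0%C) by reflexivity. clearbody q.
destruct k as [|[|[|[|k]]]]; [| | | |lia]; rewrite ?csum_S, ?csum_0;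
unfold ctheta, cshift, cdiff; cbn -[INR]; rewrite ?Hq0; simpl INR; rewrite ?RtoC_plus; ring.
Qed.

Lemma caratheodory_fun_0 (c : R) (a : nat -> C) : caratheodory_fun c a 0%C = 1%C.
Proof.
unfold caratheodory_fun. rewrite !CPS_0. unfold num_series, cmul. rewrite csum_0. simpl. field.
Qed.

Lemma class_G_caratheodory (c : R) (f : C -> C) (a : nat -> C) : 0 < c -> class_G c f
  -> summable a ->
  (forall w, unit_disk w -> f w = (w * Cexp (CPS a w))%C) ->
  twice_derivable unit_disk (caratheodory_fun c a) /\ forall z, unit_disk z -> 0
    <= Re (caratheodory_fun c a z).
Proof.
intros Hc [_ [_ HG]] Ha Hf.
assert (Hden : forall z, unit_disk z -> CPS (den_series a) z <> 0%C).
{ intros z Hz H. apply (proj1 (HG z Hz)). rewrite (C_derive_z_exp f a z Ha Hf Hz), H. ring. }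
split.
- apply twice_mult; [apply twice_CPS, summable_num, Ha|]. apply twice_inv; [exact Hden|].
  apply twice_CPS, summable_den, Ha.
- intros z Hz. destruct (HG z Hz) as [_ H]. pose proof (Hden z Hz) as Hd.
  assert (E : caratheodory_fun c a z = (1 - RtoC (2 / c) *
    (z * C_derive (C_derive f) z / C_derive f z))%C).
  { rewrite (C_derive2_z_exp f a z Ha Hf Hz), (C_derive_z_exp f a z Ha Hf Hz).
    unfold caratheodory_fun. rewrite CPS_num, CPS_ctheta by assumption.
    pose proof (Cexp_neq_0 (CPS a z)). field. split; assumption. }
  rewrite E. unfold Cminus. rewrite re_plus, re_opp, re_scal_l, re_RtoC.
  rewrite re_plus, re_RtoC in H.
  assert (H' : 2 / c * Re (z * C_derive (C_derive f) z / C_derive f z)%C <= 2 / c * (c / 2)).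
  { apply Rmult_le_compat_l; [apply Rlt_le, Rdiv_lt_0_compat|]; lra. }
  replace (2 / c * (c / 2)) with 1 in H' by (field; lra). lra.
Qed.

(** In terms of [p_j], the coefficients of the function with positive real part, the logarithmic
coefficients are [- (c/8) p_1], [- (c/24) (p_2 - (c/8) p_1^2)] and
[- (c/48) (p_3 - (c/4) p_1 p_2)], to which [caratheodory_coefficients] applies with [t = c/8] and
[t = c/4]. *)
Lemma log_coeffs_bounds (c : R) (f : C -> C) (gamma : nat -> C) :
  0 < c <= 1 -> class_G c f -> log_coeffs f gamma ->
  Cmod (gamma 1%nat) <= c / 4 /\ Cmod (gamma 2%nat) <= c / 12 /\ Cmod (gamma 3%nat) <= c / 24.
Proof.
intros Hc HG Hgamma.
destruct (log_quotient_series f gamma) as [Ha Hf]; [apply HG|exact Hgamma|].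
set (a := log_series gamma) in *.
destruct (class_G_caratheodory c f a (proj1 Hc) HG Ha Hf) as [Htw Hpos].
set (p := caratheodory_coef c a).
assert (Livingston : forall k l t, (1 <= k)%nat -> (1 <= l)%nat -> (k + l <= 3)%nat -> 0 <= t
  <= 1 ->
  Cmod (p (k + l)%nat - t * (p k * p l))%C <= 2).
{ intros k l t Hk Hl Hkl Ht.
  apply (caratheodory_coefficients (caratheodory_fun c a)); try assumption;
    try (apply caratheodory_taylor; [exact Ha|lia]).
  apply caratheodory_fun_0. }
assert (Hc0 : RtoC c <> 0%C) by (intros H; apply RtoC_inj in H; lra).
assert (Hnum : forall x : R, x <> 0 -> RtoC x <> 0%C) by (intros x Hx H; apply Hx, RtoC_inj, H).
assert (G1 : gamma 1%nat = (- RtoC (c / 8) * p 1%nat)%C).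
{ unfold p, caratheodory_coef, ctheta, cshift, cdiff, a, log_series. rewrite !RtoC_div by lra.
  simpl INR.
  field. repeat split; (exact Hc0 || apply Hnum; lra). }
assert (G2 : gamma 2%nat = (- RtoC (c / 24) * (p 2%nat - RtoC (c / 8) * (p 1%nat * p 1%nat)))%C).
{ unfold p, caratheodory_coef, ctheta, cshift, cdiff, a, log_series. rewrite !RtoC_div by lra.
  simpl INR.
  rewrite ?RtoC_plus. field. repeat split; (exact Hc0 || apply Hnum; lra). }
assert (G3 : gamma 3%nat = (- RtoC (c / 48) * (p 3%nat - RtoC (c / 4) * (p 1%nat * p 2%nat)))%C).
{ unfold p, caratheodory_coef, ctheta, cshift, cdiff, a, log_series. rewrite !RtoC_div by lra.
  simpl INR.
  rewrite ?RtoC_plus. field. repeat split; (exact Hc0 || apply Hnum; lra). }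
(* The cases [t = 0] and [t = 1] bound [p_2] and [p_2 - p_1^2] by 2, hence [p_1^2] by 4. *)
assert (B1 : Cmod (p 1%nat) <= 2).
{ pose proof (Livingston 1%nat 1%nat 0 ltac:(lia) ltac:(lia) ltac:(lia) ltac:(lra)) as A0.
  pose proof (Livingston 1%nat 1%nat 1 ltac:(lia) ltac:(lia) ltac:(lia) ltac:(lra)) as A1.
  set (x := p 1%nat) in *. set (y := p (1 + 1)%nat) in *.
  pose proof (Cmod_triangle (y - 0 * (x * x)) (- (y - 1 * (x * x)))) as T.
  rewrite Cmod_opp in T. replace (_ + _)%C with (x * x)%C in T by ring. rewrite Cmod_mult in T.
  pose proof (Cmod_ge_0 x). nra. }
pose proof (Livingston 1%nat 1%nat (c / 8) ltac:(lia) ltac:(lia) ltac:(lia) ltac:(lra)) as B2.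
pose proof (Livingston 1%nat 2%nat (c / 4) ltac:(lia) ltac:(lia) ltac:(lia) ltac:(lra)) as B3.
simpl Nat.add in B2, B3.
rewrite G1, G2, G3, !Cmod_mult, !Cmod_opp, !Cmod_R, !Rabs_pos_eq by lra.
repeat split; nra.
Qed.

Lemma csum_shift (w : nat -> C) (m : nat) : csum w (S m) = (w 0%nat + csum (fun i => w (S i)) m)%C.
Proof.
induction m as [|m IH]; [rewrite csum_S, !csum_0; reflexivity|].
rewrite csum_S, IH, csum_S. ring.
Qed.

(** * Logarithms of power series *)

(** [recip_upto u m] is correct up to index [m]; each step adds one value of the recursion
[v_(m+1) = - (u_1 v_m + u_2 v_(m-1) + ... + u_(m+1) v_0)], which depends on all the earlier ones. *)
Fixpoint recip_upto (u : nat -> C) (m : nat) : nat -> C :=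
  match m with
  | O => fun _ => 1%C
  | S m' => fun j => if (j =? S m')%nat
      then (- csum (fun i => u (S i) * recip_upto u m' (m' - i)%nat) m')%C
      else recip_upto u m' j
  end.

Definition recip (u : nat -> C) (k : nat) : C := recip_upto u k k.

Lemma recip_upto_eq (u : nat -> C) (m j : nat) : (j <= m)%nat -> recip_upto u m j = recip u j.
Proof.
induction m as [|m IH]; intros H.
- replace j with O by lia. reflexivity.
- destruct (Nat.eq_dec j (S m)) as [->|Hj]; [reflexivity|].
  simpl. destruct (Nat.eqb_spec j (S m)); [lia|]. apply IH. lia.
Qed.

Lemma recip_S (u : nat -> C) (m : nat) :
  recip u (S m) = (- csum (fun i => u (S i) * recip u (m - i)%nat) m)%C.
Proof.
unfold recip at 1. cbn [recip_upto]. rewrite Nat.eqb_refl. f_equal.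
apply csum_ext. intros i Hi. rewrite recip_upto_eq by lia. reflexivity.
Qed.

Lemma cmul_recip (u : nat -> C) (k : nat) : u 0%nat = 1%C ->
  cmul u (recip u) k = if (k =? 0)%nat then 1%C else 0%C.
Proof.
intros H0. unfold cmul. destruct k as [|m].
- rewrite csum_0, H0. unfold recip. simpl. ring.
- rewrite csum_shift, H0, Nat.sub_0_r, recip_S. simpl. ring.
Qed.

(** The recursion makes each coefficient a combination of the earlier ones with weights of total
modulus at most [1]. So the reciprocal converges in the whole disk, a fact that would otherwise
require Cauchy's theory. *)
Lemma recip_bounded (u : nat -> C) : (forall k, sum_n (fun i => Cmod (u (S i))) k <= 1) ->
  forall k, Cmod (recip u k) <= 1.
Proof.
intros Hu k. induction k as [k IH] using (well_founded_induction Nat.lt_wf_0). destruct k as [|m].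
- unfold recip. simpl. rewrite Cmod_1. lra.
- rewrite recip_S, Cmod_opp. eapply Rle_trans; [apply Cmod_csum_le|].
  eapply Rle_trans; [|apply (Hu m)]. rewrite !sum_n_Reals. apply sum_Rle. intros i Hi.
  rewrite Cmod_mult. rewrite <- (Rmult_1_r (Cmod (u (S i)))) at 2.
  apply Rmult_le_compat_l; [apply Cmod_ge_0|]. apply IH. lia.
Qed.

Lemma CPS_recip (u : nat -> C) (x : C) : u 0%nat = 1%C ->
  (forall k, sum_n (fun i => Cmod (u (S i))) k <= 1) -> summable u -> unit_disk x ->
  (CPS u x * CPS (recip u) x = 1)%C.
Proof.
intros H0 Hb Hu Hx.
rewrite <- CPS_cmul; [|exact Hu|exact (summable_bounded _ 1 (recip_bounded u Hb))|exact Hx].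
rewrite (CPS_ext _ (truncate (fun _ => RtoC 1) 0)).
- rewrite CPS_truncate, csum_0. simpl. ring.
- intros k. rewrite cmul_recip by exact H0. destruct k; reflexivity.
Qed.

(** The primitive of the logarithmic derivative. *)
Definition log_of_series (u : nat -> C) (k : nat) : C :=
  match k with O => 0%C | S j => (cmul (cdiff u) (recip u) j / INR (S j))%C end.

Lemma INR_S_neq_0 (k : nat) : RtoC (INR (S k)) <> 0%C.
Proof. intros H. apply RtoC_inj in H. revert H. apply not_0_INR. lia. Qed.

Lemma summable_log_of_series (u : nat -> C) :
  (forall k, sum_n (fun i => Cmod (u (S i))) k <= 1) -> summable u -> summable (log_of_series u).
Proof.
intros Hb Hu. apply (summable_le _ (cshift (cmul (cdiff u) (recip u)))).
- intros [|k]; simpl cshift; [simpl; lra|]. unfold log_of_series.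
  rewrite Cmod_div by apply INR_S_neq_0. rewrite Cmod_R, Rabs_pos_eq by apply pos_INR.
  assert (H : 1 <= INR (S k)) by (apply (le_INR 1); lia).
  pose proof (Cmod_ge_0 (cmul (cdiff u) (recip u) k)).
  apply (Rmult_le_reg_r (INR (S k))); [lra|]. unfold Rdiv. rewrite Rmult_assoc, Rinv_l by lra. nra.
- apply summable_cshift, summable_cmul; [apply summable_cdiff,
    Hu|exact (summable_bounded _ 1 (recip_bounded u Hb))].
Qed.

Lemma Cexp_log_of_series (u : nat -> C) (x : C) : u 0%nat = 1%C ->
  (forall k, sum_n (fun i => Cmod (u (S i))) k <= 1) -> summable u -> unit_disk x ->
  CPS u x = Cexp (CPS (log_of_series u) x).
Proof.
intros H0 Hb Hu. revert x.
pose proof (summable_log_of_series u Hb Hu) as Hl.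
apply (exp_of_log_derivative (CPS u) (CPS (log_of_series u)) (CPS (cdiff (log_of_series u)))).
- intros z Hz. apply cderiv_CPS; assumption.
- intros z Hz. eapply cderiv_eq; [apply cderiv_CPS; assumption|].
  rewrite (CPS_ext (cdiff (log_of_series u)) (cmul (cdiff u) (recip u))).
  + rewrite CPS_cmul; [|apply summable_cdiff,
      Hu|exact (summable_bounded _ 1 (recip_bounded u Hb))|exact Hz].
    rewrite <- (Cmult_1_r (CPS (cdiff u) z)) at 1. rewrite <- (CPS_recip u z H0 Hb Hu Hz). ring.
  + intros k. unfold cdiff at 1, log_of_series. field. apply INR_S_neq_0.
- rewrite !CPS_0, H0. symmetry. apply Cexp_0.
Qed.

(** * The binomial series *)

Definition ones (k : nat) : C := 1%C.

Lemma summable_ones : summable ones.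
Proof. apply (summable_bounded _ 1). intros k. unfold ones. rewrite Cmod_1. lra. Qed.

Lemma CPS_ones (x : C) : unit_disk x -> ((1 - x) * CPS ones x = 1)%C.
Proof.
intros Hx.
transitivity (CPS ones x - CPS (cshift ones) x)%C.
- rewrite CPS_cshift by (apply summable_ones || exact Hx). ring.
- rewrite (CPS_ext ones (fun k => truncate ones 0 k + cshift ones k)%C).
  + rewrite (CPS_plus (truncate ones 0) (cshift ones))
      by (apply summable_truncate || apply summable_cshift, summable_ones || exact Hx).
    rewrite CPS_truncate, csum_0. unfold ones. simpl. ring.
  + intros [|k]; unfold truncate, ones; simpl; ring.
Qed.

(** The coefficients of [log (1 - x)]. *)
Definition log1m (k : nat) : C := match k with O => 0%C | S j => (- / INR (S j))%C end.

Lemma summable_log1m : summable log1m.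
Proof.
apply (summable_bounded _ 1). intros [|k]; unfold log1m; [rewrite Cmod_0; lra|].
rewrite Cmod_opp, Cmod_inv, Cmod_R, Rabs_pos_eq by (apply pos_INR || apply INR_S_neq_0).
rewrite <- Rinv_1. apply Rinv_le_contravar; [lra|]. apply (le_INR 1). lia.
Qed.

Lemma cderiv_log1m (x : C) : unit_disk x -> cderiv (CPS log1m) x (- CPS ones x)%C.
Proof.
intros Hx. eapply cderiv_eq; [apply cderiv_CPS; [apply summable_log1m|exact Hx]|].
rewrite (CPS_ext _ (fun k => (- RtoC 1) * ones k)%C).
- rewrite CPS_scal by (apply summable_ones || exact Hx). ring.
- intros k. unfold cdiff, log1m, ones. field. apply INR_S_neq_0.
Qed.

Lemma Cexp_log1m (x : C) : unit_disk x -> (1 - x)%C = Cexp (CPS log1m x).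
Proof.
revert x. apply (exp_of_log_derivative (fun x => 1 - x)%C _ (fun x => - CPS ones x)%C).
- exact cderiv_log1m.
- intros z Hz. eapply cderiv_eq; [apply cderiv_minus; [apply cderiv_const|apply cderiv_id]|].
  transitivity (- ((1 - z) * CPS ones z))%C; [rewrite CPS_ones by exact Hz|]; ring.
- rewrite CPS_0. simpl. rewrite Cexp_0. ring.
Qed.

(** The cosine of the imaginary part has the sign of [Re (1 - x)], so it never vanishes along the
radius from [0] to [x]; by continuity the imaginary part stays between [- PI/2] and [PI/2], and
the branch is the principal one. *)
Lemma Im_log1m (x : C) : unit_disk x -> - PI < Im (CPS log1m x) <= PI.
Proof.
intros Hx. pose proof PI_RGT_0 as Hpi.
set (phi := fun t : R => Im (CPS log1m (0 + t * x)%C)).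
assert (D : forall t, 0 <= t <= 1 -> unit_disk (0 + t * x)%C).
{ intros t Ht. unfold unit_disk in *. rewrite Cplus_0_l, Cmod_mult, Cmod_R, Rabs_pos_eq by lra.
  pose proof (Cmod_ge_0 x). nra. }
assert (Hcos : forall t, 0 <= t <= 1 -> 0 < cos (phi t)).
{ intros t Ht. pose proof (Cexp_log1m _ (D t Ht)) as E.
  apply (f_equal Re) in E. rewrite (proj1 (Cexp_re_im _)) in E.
  assert (0 < Re (1 - (0 + t * x))%C).
  { pose proof (re_le_Cmod (0 + t * x)%C) as H. specialize (D t Ht). unfold unit_disk in D.
    apply Rabs_le_between in H. unfold Cminus. rewrite re_plus, re_opp, re_RtoC. lra. }
  rewrite E in H. fold (phi t) in H. pose proof (exp_pos (Re (CPS log1m (0 + t * x)%C))). nra. }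
assert (Hcont : forall t, 0 <= t <= 1 -> continuity_pt phi t).
{ intros t Ht. apply derivable_continuous_pt. eexists. apply is_derive_Reals.
  apply cderiv_line_im, cderiv_log1m, D, Ht. }
assert (E0 : phi 0 = 0).
{ unfold phi. replace (0 + 0 * x)%C with (RtoC 0) by ring. rewrite CPS_0. reflexivity. }
assert (E1 : phi 1 = Im (CPS log1m x)) by (unfold phi; do 2 f_equal; ring).
rewrite <- E1.
assert (Hup : phi 1 <= PI / 2).
{ apply Rnot_lt_le. intros H.
  destruct (Ranalysis5.IVT_interv (fun t => phi t - PI / 2) 0 1) as [t [Ht Et]].
  - intros t Ht. apply (continuity_pt_minus phi (fun _ => PI / 2)); [apply Hcont, Ht|].
    apply continuity_pt_const. intros u v; reflexivity.
  - lra.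
  - lra.
  - lra.
  - specialize (Hcos t Ht). replace (phi t) with (PI / 2) in Hcos by lra. rewrite cos_PI2 in Hcos.
    lra. }
assert (Hlo : - (PI / 2) <= phi 1).
{ apply Rnot_lt_le. intros H.
  destruct (Ranalysis5.IVT_interv (fun t => - (PI / 2) - phi t) 0 1) as [t [Ht Et]].
  - intros t Ht. apply (continuity_pt_minus (fun _ => - (PI / 2)) phi); [|apply Hcont, Ht].
    apply continuity_pt_const. intros u v; reflexivity.
  - lra.
  - lra.
  - lra.
  - specialize (Hcos t Ht). replace (phi t) with (- (PI / 2)) in Hcos by lra.
    rewrite cos_neg, cos_PI2 in Hcos. lra. }
lra.
Qed.

Lemma Cpowr_1m (x : C) (a : R) : unit_disk x -> Cpowr (1 - x)%C a = Cexp (a * CPS log1m x)%C.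
Proof.
intros Hx. unfold Cpowr. rewrite Cexp_log1m by exact Hx. rewrite Clog_Cexp; [reflexivity|].
apply Im_log1m, Hx.
Qed.

(** The product of the [1 - a / i] for [1 <= i <= k]: the coefficients of [(1 - x)^(a - 1)], which
are the partial sums of those of [(1 - x)^a]. *)
Fixpoint binom_prod (a : R) (k : nat) : R :=
  match k with O => 1 | S j => binom_prod a j * (1 - a / INR (S j)) end.

Definition binom_coef (a : R) (k : nat) : R :=
  match k with O => 1 | S j => - a * binom_prod a j / INR (S j) end.

Lemma binom_prod_pos (a : R) (k : nat) : 0 < a <= 1 -> 0 <= binom_prod a k.
Proof.
intros Ha. induction k as [|k IH]; cbn [binom_prod]; [lra|].
apply Rmult_le_pos; [exact IH|].
assert (H : 1 <= INR (S k)) by (apply (le_INR 1); lia).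
assert (a / INR (S k) <= 1). { apply (Rmult_le_reg_r (INR (S k)));
  [lra|]. unfold Rdiv. rewrite Rmult_assoc, Rinv_l by lra. lra. }
lra.
Qed.

Lemma binom_coef_sum (a : R) (k : nat) : sum_n (binom_coef a) k = binom_prod a k.
Proof.
induction k as [|k IH]; [rewrite sum_O; reflexivity|].
rewrite sum_Sn, IH.
change (binom_prod a k + binom_coef a (S k) = binom_prod a k * (1 - a / INR (S k))).
unfold binom_coef. field. apply not_0_INR. lia.
Qed.

Lemma binom_coef_neg (a : R) (k : nat) : 0 < a <= 1 -> binom_coef a (S k) <= 0.
Proof.
intros Ha. unfold binom_coef. pose proof (binom_prod_pos a k Ha).
assert (H1 : 0 < INR (S k)) by (apply (lt_INR 0); lia).
assert (0 <= a * binom_prod a k / INR (S k)).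
{ apply Rmult_le_pos; [apply Rmult_le_pos; lra|apply Rlt_le, Rinv_0_lt_compat, H1]. }
unfold Rdiv in *. lra.
Qed.

(** After the first one, the coefficients are nonpositive, and the partial sums stay nonnegative. *)
Lemma binom_coef_abs_sum (a : R) (k : nat) : 0 < a <= 1 ->
  sum_n (fun i => Rabs (binom_coef a (S i))) k <= 1.
Proof.
intros Ha.
assert (E : sum_n (fun i => Rabs (binom_coef a (S i))) k = 1 - binom_prod a (S k)).
{ induction k as [|k IH].
  - rewrite sum_O. change (Rabs (binom_coef a 1) = 1 - binom_prod a 1).
    rewrite Rabs_left1 by (apply binom_coef_neg, Ha). unfold binom_coef. cbn [binom_prod].
    simpl INR. field.
  - rewrite sum_Sn, IH, Rabs_left1 by (apply binom_coef_neg, Ha).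
    change (1 - binom_prod a (S k) + - binom_coef a (S (S k))
      = 1 - binom_prod a (S k) * (1 - a / INR (S (S k)))).
    unfold binom_coef. field. apply not_0_INR. lia. }
rewrite E. pose proof (binom_prod_pos a (S k) Ha). lra.
Qed.

Lemma summable_of_abs_sum (u : nat -> C) : (forall k, sum_n (fun i => Cmod (u (S i))) k <= 1)
  -> summable u.
Proof.
intros H. apply (summable_bounded _ (Rmax (Cmod (u 0%nat)) 1)). intros [|k]; [apply Rmax_l|].
eapply Rle_trans; [|apply Rmax_r]. eapply Rle_trans; [|apply (H k)].
destruct k as [|k]; [rewrite sum_O; lra|]. rewrite sum_Sn.
change (Cmod (u (S (S k))) <= sum_n (fun i => Cmod (u (S i))) k + Cmod (u (S (S k)))).
assert (0 <= sum_n (fun i => Cmod (u (S i))) k).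
  { rewrite sum_n_Reals. apply cond_pos_sum. intros; apply Cmod_ge_0. }
lra.
Qed.

Definition binom_series (a : R) (k : nat) : C := RtoC (binom_coef a k).

Lemma summable_binom_series (a : R) : 0 < a <= 1 -> summable (binom_series a).
Proof.
intros Ha. apply summable_of_abs_sum. intros k.
rewrite (sum_n_ext _ (fun i => Rabs (binom_coef a (S i)))) by (intros; apply Cmod_R).
apply binom_coef_abs_sum, Ha.
Qed.

Lemma csum_RtoC (u : nat -> R) (k : nat) : csum (fun i => RtoC (u i)) k = RtoC (sum_n u k).
Proof.
induction k as [|k IH]; [rewrite csum_0, sum_O; reflexivity|].
rewrite csum_S, sum_Sn, IH, <- RtoC_plus. reflexivity.
Qed.

(** Multiplying by [1 / (1 - x)] takes partial sums of the coefficients, and these are the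
[binom_prod a k]; so the derivative is [- a / (1 - x)] times the series. *)
Lemma cderiv_binom_series (a : R) (x : C) : 0 < a <= 1 -> unit_disk x ->
  cderiv (CPS (binom_series a)) x (- a * CPS ones x * CPS (binom_series a) x)%C.
Proof.
intros Ha Hx. pose proof (summable_binom_series a Ha) as Hs.
eapply cderiv_eq; [apply cderiv_CPS; assumption|].
rewrite (CPS_ext _ (fun k => (- a) * cmul (binom_series a) ones k)%C).
- rewrite (CPS_scal _ (cmul (binom_series a) ones) x (summable_cmul _ _ Hs summable_ones) Hx).
  rewrite (CPS_cmul _ _ x Hs summable_ones Hx). ring.
- intros k. unfold cmul.
  rewrite (csum_ext _ (fun i => RtoC (binom_coef a i)))
    by (intros; unfold binom_series, ones; ring).
  rewrite csum_RtoC, binom_coef_sum. unfold cdiff, binom_series, binom_coef.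
  rewrite <- RtoC_opp, <- !RtoC_mult. f_equal. field. apply not_0_INR. lia.
Qed.

Lemma binom_series_Cexp (a : R) (x : C) : 0 < a <= 1 -> unit_disk x ->
  CPS (binom_series a) x = Cexp (a * CPS log1m x)%C.
Proof.
intros Ha. revert x.
apply (exp_of_log_derivative _ (fun x => a * CPS log1m x)%C (fun x => - a * CPS ones x)%C).
- intros z Hz. eapply cderiv_eq; [apply cderiv_scal, cderiv_log1m, Hz|]. ring.
- intros z Hz. apply cderiv_binom_series; assumption.
- rewrite !CPS_0. simpl. rewrite Cmult_0_r, Cexp_0. reflexivity.
Qed.

(** * The extremal functions *)

(** The coefficients in [z] of the power series with coefficients [w] evaluated at [z^n]. *)
Definition sparse (n : nat) (w : nat -> C) (j : nat) : C :=
  if (j mod n =? 0)%nat then w (j / n)%nat else 0%C.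

Lemma csum_sparse (n : nat) (w : nat -> C) (N : nat) : (1 <= n)%nat ->
  csum (sparse n w) N = csum w (N / n).
Proof.
intros Hn. induction N as [|N IH].
- rewrite Nat.Div0.div_0_l, !csum_0. unfold sparse. rewrite Nat.Div0.mod_0_l, Nat.Div0.div_0_l.
  reflexivity.
- rewrite csum_S, IH. unfold sparse.
  pose proof (Nat.div_mod_eq N n) as E. pose proof (Nat.mod_upper_bound N n ltac:(lia)) as B.
  destruct (Nat.eq_dec (S (N mod n)) n) as [H|H].
  + assert (Q : (S N / n)%nat = S (N / n)). { symmetry. apply (Nat.div_unique (S N) n _ 0); lia. }
    assert (M : (S N mod n)%nat = O). { symmetry. apply (Nat.mod_unique (S N) n (S (N / n))); lia. }
    rewrite Q, M, csum_S. reflexivity.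
  + assert (Q : (S N / n)%nat = (N / n)%nat).
      { symmetry. apply (Nat.div_unique (S N) n _ (S (N mod n))); lia. }
    assert (M : (S N mod n)%nat = S (N mod n)).
      { symmetry. apply (Nat.mod_unique (S N) n (N / n)); lia. }
    rewrite Q, M. simpl. ring.
Qed.

Lemma cseries_sparse (n : nat) (w : nat -> C) (l : C) : (1 <= n)%nat ->
  cseries w l -> cseries (sparse n w) l.
Proof.
intros Hn H. unfold cseries, is_series in *.
apply (filterlim_ext (fun N => csum w (N / n)%nat)); [intros N; symmetry; apply csum_sparse, Hn|].
apply (filterlim_comp _ _ _ (fun N => (N / n)%nat) (csum w) eventually eventually); [|exact H].
intros P [m Hm]. exists (n * m)%nat. intros N HN. apply Hm.
apply Nat.div_le_lower_bound; lia.
Qed.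

(** If [f'(z) = (1 - z^n)^a] then [f(z) / z] is the power series with these coefficients,
evaluated at [z^n]. *)
Definition quot_series (a : R) (n : nat) (k : nat) : C := RtoC (binom_coef a k / INR (S (n * k))).

Lemma quot_series_0 (a : R) (n : nat) : quot_series a n 0 = 1%C.
Proof. unfold quot_series. rewrite Nat.mul_0_r. simpl. f_equal. field. Qed.

Lemma quot_series_abs_sum (a : R) (n k : nat) : 0 < a <= 1 ->
  sum_n (fun i => Cmod (quot_series a n (S i))) k <= 1.
Proof.
intros Ha. eapply Rle_trans; [|apply (binom_coef_abs_sum a k Ha)].
rewrite !sum_n_Reals. apply sum_Rle. intros i _. unfold quot_series. rewrite Cmod_R.
unfold Rdiv. rewrite Rabs_mult. rewrite <- (Rmult_1_r (Rabs (binom_coef a (S i)))) at 2.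
apply Rmult_le_compat_l; [apply Rabs_pos|].
assert (H : 1 <= INR (S (n * S i))) by (apply (le_INR 1); lia).
rewrite Rabs_pos_eq by (apply Rlt_le, Rinv_0_lt_compat; lra).
rewrite <- Rinv_1. apply Rinv_le_contravar; lra.
Qed.

Lemma quot_series_binom (a : R) (n : nat) (x : C) : 0 < a <= 1 -> unit_disk x ->
  (CPS (quot_series a n) x + INR n * (x * CPS (cdiff (quot_series a n)) x))%C
    = CPS (binom_series a) x.
Proof.
intros Ha Hx. pose proof (summable_of_abs_sum _ (fun k => quot_series_abs_sum a n k Ha)) as Hs.
pose proof (summable_ctheta _ Hs) as Ht.
rewrite <- (CPS_ctheta _ x Hs Hx), <- (CPS_scal _ _ x Ht Hx).
rewrite <- (CPS_plus _ _ x Hs (summable_scal _ _ Ht) Hx).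
apply CPS_ext. intros [|k]; unfold ctheta, cshift, cdiff, quot_series, binom_series.
- rewrite Nat.mul_0_r. simpl. rewrite Cmult_0_r, Cplus_0_r. f_equal. field.
- rewrite <- !RtoC_mult, <- RtoC_plus. f_equal.
  rewrite (S_INR (n * S k)), mult_INR. field.
  rewrite <- mult_INR, <- S_INR. apply not_0_INR. lia.
Qed.

Lemma unit_disk_pow (n : nat) (z : C) : (1 <= n)%nat -> unit_disk z -> unit_disk (z ^ n)%C.
Proof.
intros Hn Hz. unfold unit_disk in *. rewrite Cmod_pow. pose proof (Cmod_ge_0 z).
destruct n as [|n]; [lia|]. simpl.
assert (Cmod z ^ n <= 1) by (rewrite <- (pow1 n); apply pow_incr; lra).
assert (0 <= Cmod z ^ n) by (apply pow_le; lra). nra.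
Qed.

(** Here [CPS ones x] is [g = 1 / (1 - x)], so [x g = g - 1] is smaller in modulus than [g]; comparing
squared moduli gives [1/2 < Re g]. *)
Lemma Re_ones (x : C) : unit_disk x -> - (1/2) < Re (x * CPS ones x)%C.
Proof.
intros Hx. pose proof (CPS_ones x Hx) as E. set (g := CPS ones x) in *.
assert (E2 : (x * g = g - 1)%C). { rewrite <- E. ring. }
assert (Hg : g <> 0%C). { intros H. rewrite H, Cmult_0_r in E. apply C1_nz. auto. }
apply Cmod_gt_0 in Hg.
assert (H : Cmod (x * g) < Cmod g). { rewrite Cmod_mult. unfold unit_disk in Hx. nra. }
pose proof (Cmod_ge_0 (x * g)%C).
assert (H2 : Cmod (x * g) * Cmod (x * g) < Cmod g * Cmod g) by nra.
rewrite !Cmod_sqr, E2 in H2. rewrite E2.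
destruct g as [g1 g2]. unfold Re, Im, Cminus, Cplus, Copp, RtoC in *; simpl in *. nra.
Qed.

(** The function [f(z) = z U(z^n)], with [U] the series [quot_series (c / n) n], has [f'(z)] equal to
the binomial series at [z^n]. Its logarithmic coefficient of order [n] is half the first coefficient
of [log U], which is that of [U]: [- (c / n) / (n + 1)]. *)
Lemma extremal_function (c : R) (n : nat) : 0 < c <= 1 -> (1 <= n)%nat ->
  exists f : C -> C, class_G c f /\ extremal c n f /\
    exists gamma : nat -> C, log_coeffs f gamma /\ Cmod (gamma n) = c / (2 * INR n * (INR n + 1)).
Proof.
intros Hc Hn.
assert (HnR : 1 <= INR n) by (apply (le_INR 1); exact Hn).
set (a := c / INR n).
assert (Ha : 0 < a <= 1).
{ split; [apply Rdiv_lt_0_compat; lra|]. unfold a. apply (Rmult_le_reg_r (INR n)); [lra|].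
  unfold Rdiv. rewrite Rmult_assoc, Rinv_l by lra. lra. }
set (u := quot_series a n).
assert (Hsum : forall k, sum_n (fun i => Cmod (u (S i))) k <= 1)
  by (intros k; apply quot_series_abs_sum, Ha).
assert (Hu : summable u) by (apply summable_of_abs_sum, Hsum).
set (F := CPS (binom_series a)).
assert (Hpow : forall z, unit_disk z -> unit_disk (z ^ n)%C)
  by (intros; apply unit_disk_pow; assumption).
assert (H0n : (0 ^ n)%C = 0%C) by (destruct n; [lia|]; simpl; ring).
assert (Hnz : forall z, (z * (INR n * z ^ pred n) = INR n * z ^ n)%C).
{ intros z. destruct n as [|m]; [lia|]. cbn [pred]. rewrite Cpow_S. ring. }
set (f := fun z => (z * CPS u (z ^ n))%C).
assert (Df : forall z, unit_disk z -> cderiv f z (F (z ^ n)%C)).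
{ intros z Hz. eapply cderiv_eq.
  - apply cderiv_mult; [apply cderiv_id|].
    apply (cderiv_comp (CPS u) (fun z => z ^ n)%C); [apply cderiv_CPS; auto|apply cderiv_pow].
  - cbv beta. unfold F. rewrite <- (quot_series_binom a n) by auto. fold u.
    rewrite (Cmult_assoc (INR n)), <- Hnz. ring. }
assert (HF : forall x, unit_disk x -> F x <> 0%C).
{ intros x Hx. unfold F. rewrite binom_series_Cexp by assumption. apply Cexp_neq_0. }
assert (Df2 : forall z, unit_disk z -> cderiv (C_derive f) z
  (INR n * z ^ pred n * (- a * CPS ones (z ^ n) * F (z ^ n)))%C).
{ intros z Hz. destruct (disk_neighbourhood z Hz) as [d [Hd Hnear]].
  apply (cderiv_ext_ball (fun w => F (w ^ n)%C) _ _ _ d Hd).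
  - intros w Hw. symmetry. apply is_C_derive_unique, Df, Hnear, Hw.
  - apply (cderiv_comp F (fun z => z ^ n)%C); [apply cderiv_binom_series; auto|apply cderiv_pow]. }
assert (D1 : forall z, unit_disk z -> C_derive f z = F (z ^ n)%C)
  by (intros; apply is_C_derive_unique, Df; assumption).
assert (Hf0 : f 0%C = 0%C) by (unfold f; ring).
exists f. split; [|split].
- split; [split; [|split; [exact Hf0|]]|split].
  + intros z Hz. eexists. apply Df, Hz.
  + rewrite D1, H0n by exact unit_disk_0. unfold F. rewrite CPS_0. reflexivity.
  + intros z Hz. eexists. apply Df2, Hz.
  + intros z Hz. rewrite (is_C_derive_unique _ _ _ (Df2 z Hz)), D1 by exact Hz.
    split; [apply HF; auto|].
    replace (1 + z * (INR n * z ^ pred n * (- a * CPS ones (z ^ n) * F (z ^ n))) / F (z ^ n))%C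
      with (1 - RtoC c * (z ^ n * CPS ones (z ^ n)))%C.
    * unfold Cminus. rewrite re_plus, re_opp, re_scal_l, re_RtoC.
      pose proof (Re_ones (z ^ n)%C (Hpow z Hz)). nra.
    * replace (RtoC c) with (RtoC (INR n) * RtoC a)%C
        by (rewrite <- RtoC_mult; f_equal; unfold a; field; lra).
      transitivity (1 + (z * (INR n * z ^ pred n)) * (- a * CPS ones (z ^ n)))%C;
        [rewrite Hnz; ring|].
      field. apply HF. auto.
- split; [exact Hf0|]. intros z Hz. rewrite Cpowr_1m by auto. fold a.
  rewrite <- binom_series_Cexp by auto. apply Df, Hz.
- set (l := log_of_series u).
  assert (Hl : summable l) by (apply summable_log_of_series; assumption).
  exists (fun k => sparse n l k / 2)%C. split.
  + exists (fun z => CPS l (z ^ n)%C). split; [split; [|split]|].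
    * intros z Hz. eexists.
      apply (cderiv_comp (CPS l) (fun z => z ^ n)%C); [apply cderiv_CPS; auto|apply cderiv_pow].
    * rewrite H0n, CPS_0. reflexivity.
    * intros z Hz Hz0. unfold l. rewrite <- Cexp_log_of_series; auto.
      -- unfold f. field. exact Hz0.
      -- apply quot_series_0.
    * intros z Hz.
      assert (H : cseries (fun k => sparse n l k * z ^ k)%C (CPS l (z ^ n)%C)).
      { eapply cseries_ext; [|apply (cseries_sparse n (fun k => l k * (z ^ n) ^ k)%C);
          [exact Hn|apply CPS_correct; auto]].
        intros k. unfold sparse. destruct (Nat.eqb_spec (k mod n) 0) as [E|E]; [|ring].
        rewrite <- Cpow_mult_r. do 2 f_equal. pose proof (Nat.div_mod_eq k n). lia. }
      assert (E0 : (sparse n l 0 * z ^ 0)%C = 0%C).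
      { unfold sparse. rewrite Nat.Div0.mod_0_l, Nat.Div0.div_0_l. simpl. ring. }
      apply (cseries_ext (fun k => sparse n l (S k) * z ^ S k)%C). { intros k. field. }
      apply (cseries_incr (fun k => sparse n l k * z ^ k)%C). rewrite E0, Cplus_0_r. exact H.
  + unfold sparse. rewrite Nat.Div0.mod_same, Nat.div_same by lia.
    assert (E1 : l 1%nat = RtoC (- a / (INR n + 1))).
    { unfold l, log_of_series, cmul. rewrite csum_0. unfold cdiff, recip, u, quot_series.
      cbn [Nat.sub recip_upto].
      rewrite Nat.mul_1_r, (S_INR n).
      replace (binom_coef a 1 / (INR n + 1)) with (- a / (INR n + 1))
        by (unfold binom_coef, binom_prod; simpl INR; field; lra).
      set (y := RtoC (- a / (INR n + 1))). simpl INR. field. }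
    simpl Nat.eqb. cbv iota. rewrite E1.
    rewrite Cmod_div, !Cmod_R by (intros H; apply RtoC_inj in H; lra).
    rewrite (Rabs_pos_eq 2) by lra. unfold Rdiv at 2.
    rewrite Rabs_mult, Rabs_Ropp, (Rabs_pos_eq a), (Rabs_pos_eq (/ (INR n + 1)))
      by (try apply Rlt_le, Rinv_0_lt_compat; lra).
    unfold a. field. lra.
Qed.

Theorem theorem2p10 : forall c : R, 0 < c <= 1 ->
  (forall (f : C -> C) (gamma : nat -> C),
     class_G c f -> log_coeffs f gamma ->
     Cmod (gamma 1%nat) <= c / 4 /\
     Cmod (gamma 2%nat) <= c / 12 /\
     Cmod (gamma 3%nat) <= c / 24) /\
  (exists f : C -> C, class_G c f /\ extremal c 1 f /\
     exists gamma : nat -> C,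
       log_coeffs f gamma /\ Cmod (gamma 1%nat) = c / 4) /\
  (exists f : C -> C, class_G c f /\ extremal c 2 f /\
     exists gamma : nat -> C,
       log_coeffs f gamma /\ Cmod (gamma 2%nat) = c / 12) /\
  (exists f : C -> C, class_G c f /\ extremal c 3 f /\
     exists gamma : nat -> C,
       log_coeffs f gamma /\ Cmod (gamma 3%nat) = c / 24).
Proof.
intros c Hc. split; [|split; [|split]].
- intros f gamma. apply log_coeffs_bounds, Hc.
- destruct (extremal_function c 1 Hc (le_n 1)) as [f [HG [HE [gamma [Hl Hg]]]]].
  exists f. split; [exact HG|split; [exact HE|]]. exists gamma. split; [exact Hl|].
  rewrite Hg. simpl INR. field.
- destruct (extremal_function c 2 Hc ltac:(lia)) as [f [HG [HE [gamma [Hl Hg]]]]].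
  exists f. split; [exact HG|split; [exact HE|]]. exists gamma. split; [exact Hl|].
  rewrite Hg. simpl INR. field.
- destruct (extremal_function c 3 Hc ltac:(lia)) as [f [HG [HE [gamma [Hl Hg]]]]].
  exists f. split; [exact HG|split; [exact HE|]]. exists gamma. split; [exact Hl|].
  rewrite Hg. simpl INR. field.
Qed.
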